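(* Let $(p_j)_{j\ge 1}$ satisfy $0\le p_j<1$ for all $j$, $0<p_1<1$, and $\sum_{k=1}^\infty (1-p_1)\cdots(1-p_k)<\infty$. In the random directed line graph on $\mathbb{Z}$ with connection probabilities $(p_j)$, let $(\Gamma_k)_{k\in\mathbb{Z}}$ be the enumeration of the skeleton and let $\mathscr{C}_k$, $k\in\mathbb{Z}$, be the cycles. Then the cycles $(\mathscr{C}_k,\ k\in\mathbb{Z})$ are independent, and $(\mathscr{C}_k,\ k\in\mathbb{Z}\setminus\{0\})$ are identically distributed. In particular, the skeleton vertices $(\Gamma_k,\ k\in\mathbb{Z})$ form a stationary renewal process.
   Context: Random directed line graph: for $i<j$ integers, $\alpha_{i,j}$ are independent random variables with $\mathbb{P}(\alpha_{i,j}=1)=p_{j-i}=1-\mathbb{P}(\alpha_{i,j}=-\infty)$; $(i,j)$ is a directed edge iff $\alpha_{i,j}=1$. For $i<j$ write $i\leadsto j$ if there is a path $i=i_0<i_1<\cdots<i_\ell=j$ of edges. For $n\in\mathbb{Z}$ let $\boldsymbol\delta^{(n)}=(\alpha_{n,n+m})_{m\ge1}$ be the vector of outgoing connections of $n$. Skeleton: $\mathscr{S}$ is the random set of $n\in\mathbb{Z}$ such that $n\leadsto j$ for all $j>n$ and $j\leadsto n$ for all $j<n$. Under the stated assumptions it is a.s. unbounded in both directions and its elements are enumerated as $\cdots<\Gamma_{-1}<\Gamma_0\le0<\Gamma_1<\Gamma_2<\cdots$. Cycles: $\mathscr{C}_k$ is the finite sequence $(\boldsymbol\delta^{(n)},\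 \Gamma_k\le n<\Gamma_{k+1})$, regarded as a random sequence of random length $\Gamma_{k+1}-\Gamma_k$ indexed from its starting point, i.e. $\mathscr{C}_k=(\boldsymbol\delta^{(\Gamma_k+m)},\ 0\le m<\Gamma_{k+1}-\Gamma_k)$. Stationary renewal process on $\mathbb{Z}$: the random set $\{\Gamma_k\}$ has a law invariant under integer translations, the gaps $\Gamma_{k+1}-\Gamma_k$, $k\in\mathbb{Z}$, are independent, and those with $k\ne0$ are identically distributed. *)

(* Defs.v *)
From HB Require Import structures.
From mathcomp Require Import all_boot all_order all_algebra finmap.
From mathcomp Require Import all_classical all_reals all_analysis.
From mathcomp Require Import measurable_realfun.

Set Implicit Arguments.
Unset Strict Implicit.
Unset Printing Implicit Defensive.

Import Order.TTheory GRing.Theory Num.Theory.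
Local Open Scope classical_set_scope.
Local Open Scope ring_scope.

HB.instance Definition _ := isPointed.Build int 0.
HB.instance Definition _ := @isMeasurable.Build default_measure_display
  int discrete_measurable discrete_measurable0
  discrete_measurableC discrete_measurableU.

(* Infinite sequences in E, with the product sigma-algebra. *)
Definition nat_product d (E : measurableType d) :=
  g_sigma_algebraType (\bigcup_(m in [set: nat])
    preimage_set_system [set: nat -> E] (fun x => x m) measurable).

(* Finite sequences of arbitrary length, i.e. the disjoint union over n of the
   product spaces E^n: a set is measurable iff its trace on each E^n is. *)
Definition fin_seq (E : Type) := seq E.

Definition fin_seq_display : measure_display -> measure_display.
Proof. exact. Qed.

Section FinSeqMeasurable.
Context d (E : measurableType d).

Definition fin_seq_measurable (A : set (fin_seq E)) : Prop :=
  forall n : nat, measurable [set t : n.-tuple E | A (tval t)].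

Lemma fin_seq_measurable0 : fin_seq_measurable set0.
Proof. by move=> n; exact: measurable0. Qed.

Lemma fin_seq_measurableC (A : set (fin_seq E)) :
  fin_seq_measurable A -> fin_seq_measurable (~` A).
Proof. by move=> mA n; exact: measurableC (mA n). Qed.

Lemma fin_seq_measurable_bigcup (F : nat -> set (fin_seq E)) :
  (forall i, fin_seq_measurable (F i)) ->
  fin_seq_measurable (\bigcup_i F i).
Proof.
move=> mF n.
exact: (bigcup_measurable (fun k (_ : setT k) => mF k n)).
Qed.

HB.instance Definition _ := Choice.on (fin_seq E).
HB.instance Definition _ := isPointed.Build (fin_seq E) [::].
HB.instance Definition _ := @isMeasurable.Build (fin_seq_display d)
  (fin_seq E) fin_seq_measurable fin_seq_measurable0
  fin_seq_measurableC fin_seq_measurable_bigcup.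

End FinSeqMeasurable.

(* Subsets of Z, with the sigma-algebra generated by the events "m belongs to
   the set". *)
Definition int_set :=
  g_sigma_algebraType
    (range (fun m : int => [set S : set int | S m])).

Section Probability.
Context d (T : measurableType d) (R : realType) (P : probability T R).

Definition independent (I : choiceType) d' (E : measurableType d')
    (X : I -> T -> E) : Prop :=
  (forall i, measurable_fun [set: T] (X i)) /\
  forall (J : {fset I}) (A : I -> set E), (forall i, measurable (A i)) ->
    P (\bigcap_(i in [set` J]) (X i @^-1` A i)) =
    (\prod_(i <- J) P (X i @^-1` A i))%E.

Definition same_law d' (E : measurableType d') (X Y : T -> E) : Prop :=
  forall A, measurable A -> P (X @^-1` A) = P (Y @^-1` A).

Definition stationary_set (S : T -> int_set) : Prop :=
  measurable_fun [set: T] S /\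
  forall n : int, same_law S (fun w => [set x + n | x in S w]).

Definition stationary_renewal (G : int -> T -> int) : Prop :=
  let gap k w := G (k + 1) w - G k w in
  [/\ stationary_set (fun w => range (fun k => G k w)),
      independent gap &
      forall k l : int, k != 0 -> l != 0 -> same_law (gap k) (gap l)].

End Probability.

Definition leads (e : rel int) (i j : int) : Prop :=
  i < j /\ exists s : seq int, path e i s /\ last i s = j.

Definition enumerates (S : set int) (g : int -> int) : Prop :=
  [/\ {homo g : k l / k < l}, range g = S & g 0 <= 0 < g 1].

Section LineGraph.
Context d (T : measurableType d) (R : realType).

Definition random_line_graph (P : probability T R) (p : nat -> R)
    (alpha : int -> int -> T -> \bar R) : Prop :=
  independent P
    (fun e : {e : int * int | e.1 < e.2} => alpha (val e).1 (val e).2) /\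
  forall i j : int, i < j ->
    P [set w | alpha i j w = 1%E] = (p `|j - i|%N)%:E /\
    P [set w | alpha i j w = -oo%E] = (1 - p `|j - i|%N)%:E.

Variable alpha : int -> int -> T -> \bar R.

Definition edge (w : T) : rel int :=
  fun i j => (i < j) && (alpha i j w == 1%E).

Definition skeleton (w : T) : set int :=
  [set n | (forall j, n < j -> leads (edge w) n j) /\
           (forall j, j < n -> leads (edge w) j n)].

(* The enumeration is unique when it exists, which is almost surely the case
   for the graphs of interest; Gamma is identically 0 otherwise. *)
Definition Gamma (k : int) (w : T) : int :=
  xget (fun=> 0) [set g | enumerates (skeleton w) g] k.

(* Entry m (counted from 0) is the connection from n to n + m + 1. *)
Definition delta (n : int) (w : T) : nat_product (\bar R) :=
  fun m => alpha n (n + m.+1%:Z) w.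

Definition skeleton_cycle (k : int) (w : T) : fin_seq (nat_product (\bar R)) :=
  mkseq (fun m => delta (Gamma k w + m%:Z) w)
        `|Gamma (k + 1) w - Gamma k w|%N.

End LineGraph.

(* Main.v *)
Require Import Defs.
From mathcomp Require Import all_boot all_order all_algebra finmap.
From mathcomp Require Import all_classical all_reals all_analysis.
From mathcomp Require Import measurable_realfun.
From mathcomp Require Import zify ring lra.

(* A vertex [n] leads to everything on its right iff every [j > n] has an
   in-edge from [n, j) (rinf), and everything on its left leads to [n] iff every
   [j < n] has an out-edge into (j, n] (linf).  The first event depends only on the
   rows [delta m] with [m >= n], the second only on those with [m < n].
   Moreover [a < b] are consecutive skeleton vertices iff "everything before
   [a] leads to [a]", "[b] leads to everything after it", and a condition on
   the rows [a <= m < b] holds.  As the rows are i.i.d., the probability that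
   prescribed vertices are consecutive skeleton points with cycles in
   prescribed sets factorizes; summing over the positions gives
     P(C_k in D_k, -n <= k <= m) = kappa(D_0) * prod_(k <> 0) beta(D_k),
   with beta independent of [k], and the normalizations kappa(T) = beta(T) = 1
   follow by taking all D_k full.  The skeleton is almost surely unbounded by
   the second moment method: distant vertices belong to it almost
   independently.  Stationarity is shift invariance of the rows. *)

Set Implicit Arguments.
Unset Strict Implicit.
Unset Printing Implicit Defensive.

Import Order.TTheory GRing.Theory Num.Theory.
Local Open Scope classical_set_scope.
Local Open Scope ring_scope.

(** * Covering conditions and enumeration *)

(** The probability space of the statement carries no translations, so everything is computed for
    the law of the rows on the canonical space [config], on which a shift acts. A sum over positions
    is a probability only if the events are disjoint, and the rows in [[a, b)] do not single out
    [b]: several [b] may satisfy [cycle_block] with the same [a]. Uniqueness comes from [rinf] at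
    [b] (or [linf] on the left), so each chain of cycles keeps the condition at its outermost vertex
    and passes it inward along links. Index 0 has its own law because its cycle is the one around
    the origin: both of its endpoints are summed over, while any other cycle has one endpoint fixed
    by its neighbour. The summability hypothesis yields positivity: [(1 - p_1)...(1 - p_j)] is the
    chance that a vertex is joined to none of the [j] vertices next to it on one side, so a union
    bound covers all distant vertices, and edges of length one cover the finitely many others. *)

Definition rcov (e : rel int) (a b : int) : Prop :=
  forall j, a < j <= b -> exists i, (a <= i < j) /\ e i j.

Definition lcov (e : rel int) (a b : int) : Prop :=
  forall j, a <= j < b -> exists i, (j < i <= b) /\ e j i.

Definition rinf (e : rel int) (a : int) : Prop := forall b, rcov e a b.

Definition linf (e : rel int) (b : int) : Prop := forall a, lcov e a b.

Definition link (e : rel int) (a b : int) : Prop := rcov e a b /\ lcov e a b.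

(** Being a skeleton vertex between [a] and [b] involves all rows; testing it by links to the two
    ends keeps the condition within the rows of [[a, b)]. *)
Definition cycle_block (e : rel int) (a b : int) : Prop :=
  link e a b /\ forall k, a < k < b -> ~ (link e a k /\ link e k b).

Definition consecutive (S : set int) (a b : int) : Prop :=
  [/\ S a, S b, a < b & forall x, a < x < b -> ~ S x].

Definition unbounded (S : set int) : Prop :=
  forall m, (exists2 n, S n & m < n) /\ (exists2 n, S n & n < m).

Section Leads.
Variable e : rel int.
Hypothesis e_lt : forall i j, e i j -> i < j.

Lemma leads_edge i j : e i j -> leads e i j.
Proof.
by move=> eij; split; [exact: e_lt|exists [:: j]; rewrite /= eij].
Qed.

Lemma leads_trans j i k : leads e i j -> leads e j k -> leads e i k.
Proof.
move=> [lij [s [es ls]]] [ljk [t [et lt']]]; split; first exact: lt_trans ljk.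
by exists (s ++ t); rewrite cat_path last_cat es ls.
Qed.

Lemma path_le s i : path e i s -> i <= last i s.
Proof.
elim: s i => //= j s IH i /andP[/e_lt /ltW ij /IH]; exact: le_trans.
Qed.

Lemma leads_first i j : leads e i j -> exists k, (i < k <= j) /\ e i k.
Proof.
move=> [ij [[|k s] /= [es ls]]]; first by rewrite ls ltxx in ij.
case/andP: es => eik es; exists k; split=> //.
by rewrite e_lt //= -ls path_le.
Qed.

Lemma leads_last i j : leads e i j -> exists k, (i <= k < j) /\ e k j.
Proof.
move=> [ij [s]]; case: (lastP s) => [[_ /= ls]|{}s k].
  by rewrite ls ltxx in ij.
rewrite rcons_path last_rcons => -[/andP[es ek] kj]; rewrite kj in ek.
by exists (last i s); rewrite path_le // e_lt.
Qed.

(** Going back from [j] along in-edges whose sources stay at or after [a] strictly decreases, so it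
    can only stop at [a]; conversely the last edge of a path from [a] supplies the in-edge. *)
Lemma rinfP a : rinf e a <-> forall j, a < j -> leads e a j.
Proof.
split=> [ra j aj|H b j /andP[aj _]]; last exact: leads_last (H _ aj).
have [n] := ubnP `|j - a|%N; elim: n j aj => // n IH j aj jn.
have [|i [/andP[ai ij] eij]] := ra j j; first by rewrite aj lexx.
have [->|ia] := eqVneq a i; first exact: leads_edge.
by apply: (@leads_trans i); [apply: IH; lia|exact: leads_edge].
Qed.

Lemma linfP b : linf e b <-> forall j, j < b -> leads e j b.
Proof.
split=> [rb j jb|H a j /andP[_ jb]]; last exact: leads_first (H _ jb).
have [n] := ubnP `|b - j|%N; elim: n j jb => // n IH j jb jn.
have [|i [/andP[ai ij] eij]] := rb j j; first by rewrite jb lexx.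
have [<-|ia] := eqVneq i b; first exact: leads_edge.
by apply: (@leads_trans i); [exact: leads_edge|apply: IH; lia].
Qed.

End Leads.

Section Cover.
Variable e : rel int.


Lemma linf_link a b : a < b -> linf e a -> link e a b -> linf e b.
Proof.
move=> ab la [_ lab] c j /andP[_ jb].
have [aj|ja] := leP a j; first by apply: lab; rewrite aj.
have [|i [ji eji]] := la j j; first by rewrite lexx.
by exists i; split => //; lia.
Qed.

Lemma rinf_link a b : a < b -> rinf e b -> link e a b -> rinf e a.
Proof.
move=> ab rb [rab _] c j /andP[aj _].
have [jb|bj] := leP j b; first by apply: rab; rewrite aj.
have [|i [ij eij]] := rb j j; first by rewrite lexx bj.
by exists i; split => //; lia.
Qed.

Lemma link_inf a b : rinf e a -> linf e b -> link e a b.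
Proof. by move=> ra lb; split; [exact: ra|exact: lb]. Qed.

Lemma link_rinf a b c : a < b < c -> rinf e b -> link e a c -> link e b c.
Proof.
move=> abc rb [_ lac]; split; first exact: rb.
by move=> j jc; apply: lac; lia.
Qed.

Lemma link_linf a b c : a < b < c -> linf e b -> link e a c -> link e a b.
Proof.
move=> abc lb [rac _]; split; last exact: lb.
by move=> j jc; apply: rac; lia.
Qed.

Let S := [set n | linf e n /\ rinf e n].

(** An interior [k] linked to both ends inherits [linf] from [a] and [rinf] from [b], hence would be
    in [S]; conversely, an interior element of [S] cuts [link e a b] into links with each end. The
    three conditions on the right live on disjoint sets of rows. *)
Lemma consecutiveP a b : a < b ->
  consecutive S a b <-> [/\ linf e a, cycle_block e a b & rinf e b].
Proof.
move=> ab; split.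
  move=> [[la ra] [lb rb] _ nS]; split=> //; split; first exact: link_inf.
  move=> k akb [lak lkb]; apply: (nS k akb); split.
    by apply: linf_link lak => //; lia.
  by apply: rinf_link lkb => //; lia.
move=> [la [lab nk] rb]; split=> //.
- by split=> //; exact: rinf_link lab.
- by split=> //; exact: linf_link lab.
- move=> k akb [lk rk]; apply: (nk k akb).
  by split; [exact: link_linf lab|exact: link_rinf lab].
Qed.

(** If [b < b'], then [rinf e b] and the out-edges in [link e a b'] link [b] to [b'], so [b] is an
    interior vertex that the longer block forbids. This makes sums over block lengths disjoint. *)
Lemma cycle_block_inj_r a b b' : a < b -> a < b' ->
  cycle_block e a b -> cycle_block e a b' -> rinf e b -> rinf e b' -> b = b'.
Proof.
move=> ab ab' [lb nb] [lb' nb'] rb rb'.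
have [bb'|bb'|//] := ltgtP b b'; exfalso.
- by apply: (nb' b); [lia|split=> //; apply: link_rinf lb' => //; lia].
- by apply: (nb b'); [lia|split=> //; apply: link_rinf lb => //; lia].
Qed.

Lemma cycle_block_inj_l a b b' : b < a -> b' < a ->
  cycle_block e b a -> cycle_block e b' a -> linf e b -> linf e b' -> b = b'.
Proof.
move=> ab ab' [lb nb] [lb' nb'] rb rb'.
have [bb'|bb'|//] := ltgtP b b'; exfalso.
- by apply: (nb b'); [lia|split=> //; apply: link_linf lb => //; lia].
- by apply: (nb' b); [lia|split=> //; apply: link_linf lb' => //; lia].
Qed.

End Cover.

Lemma skeletonE d (T : measurableType d) (R : realType)
  (alpha : int -> int -> T -> \bar R) w :
  skeleton alpha w = [set n | linf (edge alpha w) n /\ rinf (edge alpha w) n].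
Proof.
have elt i j : edge alpha w i j -> i < j by case/andP.
apply/seteqP; split=> n /=.
  by move=> [r l]; split; [apply/(linfP elt)|apply/(rinfP elt)].
by move=> [/(linfP elt) l /(rinfP elt) r].
Qed.

(** * Enumerating a set of integers unbounded in both directions *)

Section Enumeration.
Variable S : set int.

Lemma least_above a : (exists2 n, S n & a < n) ->
  exists b, [/\ S b, a < b & forall x, a < x < b -> ~ S x].
Proof.
move=> [n Sn an].
have ex : exists m : nat, `[< S (a + m.+1%:Z) >].
  exists `|n - a|.-1; apply/asboolP.
  by have -> : a + `|n - a|.-1.+1%:Z = n by lia.
have [m /asboolP Sm mmin] := ex_minnP ex.
exists (a + m.+1%:Z); split=> // [|x /andP[ax xm] Sx]; first by lia.
have := mmin `|x - a|.-1.
have -> : a + `|x - a|.-1.+1%:Z = x by lia.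
by move/(_ (asboolT Sx)); lia.
Qed.

Lemma greatest_below a : (exists2 n, S n & n < a) ->
  exists b, [/\ S b, b < a & forall x, b < x < a -> ~ S x].
Proof.
move=> [n Sn an].
have ex : exists m : nat, `[< S (a - m.+1%:Z) >].
  exists `|a - n|.-1; apply/asboolP.
  by have -> : a - `|a - n|.-1.+1%:Z = n by lia.
have [m /asboolP Sm mmin] := ex_minnP ex.
exists (a - m.+1%:Z); split=> // [|x /andP[ax xm] Sx]; first by lia.
have := mmin `|a - x|.-1.
have -> : a - `|a - x|.-1.+1%:Z = x by lia.
by move/(_ (asboolT Sx)); lia.
Qed.

Lemma consecutive_fun a b b' :
  consecutive S a b -> consecutive S a b' -> b = b'.
Proof.
move=> [_ Sb ab nb] [_ Sb' ab' nb'].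
have [bb'|bb'|//] := ltgtP b b'; exfalso.
- by apply: (nb' b) => //; lia.
- by apply: (nb b') => //; lia.
Qed.

Lemma consecutive_inj a a' b :
  consecutive S a b -> consecutive S a' b -> a = a'.
Proof.
move=> [Sb _ ab nb] [Sb' _ ab' nb'].
have [bb'|bb'|//] := ltgtP a a'; exfalso.
- by apply: (nb a') => //; lia.
- by apply: (nb' a) => //; lia.
Qed.

Lemma ltz_homo (g : int -> int) :
  (forall k, g k < g (k + 1)) -> {homo g : k l / k < l}.
Proof.
move=> H k l kl.
have -> : l = k + `|l - k|.-1.+1%:Z by lia.
elim: (`|l - k|.-1) => [|n IH]; first exact: H.
by apply: lt_trans IH _; rewrite -[n.+2]addn1 PoszD addrA H.
Qed.

Lemma enumerates_exists : unbounded S -> exists g, enumerates S g.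
Proof.
move=> uS.
have nexP a : S a -> exists b, consecutive S a b.
  by move=> Sa; have [b [Sb ab nb]] := least_above (uS a).1; exists b.
have prevP b : S b -> exists a, consecutive S a b.
  by move=> Sb; have [a [Sa ab nb]] := greatest_below (uS b).2; exists a.
pose nx a := xget 0 [set b | consecutive S a b].
pose pv b := xget 0 [set a | consecutive S a b].
have nxP a : S a -> consecutive S a (nx a).
  by move=> /nexP[b ab]; rewrite /nx; case: xgetP => [//|/(_ b)].
have pvP b : S b -> consecutive S (pv b) b.
  by move=> /prevP[a ab]; rewrite /pv; case: xgetP => [//|/(_ a)].
(* The largest element below 1 is the largest one that is at most 0, as the normalization
   [g 0 <= 0 < g 1] requires. *)
have [g0 [Sg0 g0_le g0P]] := greatest_below (uS 1).2.
pose g k := match k with Posz n => iter n nx g0 | Negz n => iter n.+1 pv g0 end.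
have SP n : S (iter n nx g0).
  by elim: n => //= n IH; have [] := nxP _ IH.
have SN n : S (iter n pv g0).
  by elim: n => //= n IH; have [] := pvP _ IH.
have gS k : S (g k) by case: k => n; [exact: SP|exact: SN].
have gC k : consecutive S (g k) (g (k + 1)).
  case: k => n.
    by rewrite -PoszD addn1 /=; exact/nxP/SP.
  have -> : Negz n + 1 = - n%:Z by lia.
  have -> : g (- n%:Z) = iter n pv g0 by case: n.
  exact/pvP/SN.
have g00 : g 0 = g0 by [].
have gmono : {homo g : k l / k < l} by apply: ltz_homo => k; have [] := gC k.
clearbody g; exists g; split=> //.
- apply/seteqP; split=> [_ [k _ <-]//|x Sx].
  (* Induction on the distance to [g 0]: the neighbour of [x] in [S] on the side of [g 0] is closer,
     and it cannot jump over [g 0], which is itself in [S]. *)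
  suff [k <-] : exists k, g k = x by exists k.
  have [n] := ubnP `|x - g 0|%N; elim: n x Sx => // n IH x Sx xn.
  have [xg|gx|->] := ltgtP x (g 0); last by exists 0.
    have [y Cxy] := nexP _ Sx.
    have [_ Sy xy ny] := Cxy.
    have yg : y <= g 0.
      by rewrite leNgt; apply/negP => yg; apply: (ny (g 0)); [exact/andP|exact: gS].
    have [|k gk] := IH y Sy; first by clear -xy yg xn; move: (g 0) xy yg xn => z; lia.
    exists (k - 1); apply: consecutive_inj Cxy.
    by have := gC (k - 1); rewrite subrK gk.
  have [y Cxy] := prevP _ Sx.
  have [Sy _ xy ny] := Cxy.
  have yg : g 0 <= y.
    by rewrite leNgt; apply/negP => yg; apply: (ny (g 0)); [exact/andP|exact: gS].
  have [|k gk] := IH y Sy; first by clear -xy yg xn; move: (g 0) xy yg xn => z; lia.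
  exists (k + 1); apply: (@consecutive_fun y) Cxy.
  by rewrite -gk.
- rewrite g00; apply/andP; split; first by lia.
  rewrite ltNge; apply/negP => g1.
  have [_ S1 lt1 _] := gC 0.
  by apply: (g0P (g (0 + 1))) => //; rewrite add0r; move: (g 1) lt1 g1 => z; lia.
Qed.

Section Enumerated.
Variable g : int -> int.
Hypothesis gS : enumerates S g.

Lemma enumerates_consecutive k : consecutive S (g k) (g (k + 1)).
Proof.
case: gS => gm gr _.
have gle x y : g x < g y -> x < y.
  move=> gxy; rewrite ltNge le_eqVlt; apply/negP => /orP[/eqP yx|/gm].
    by rewrite yx ltxx in gxy.
  by move/lt_trans => /(_ _ gxy); rewrite ltxx.
split; [by rewrite -gr; exists k|by rewrite -gr; exists (k + 1)| |].
  by apply: gm; lia.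
by move=> x /andP[kx xk]; rewrite -gr => -[l _ lx]; move: kx xk;
   rewrite -lx => /gle kl /gle lk; lia.
Qed.

Lemma enumerates_in k : S (g k).
Proof. by have [] := enumerates_consecutive k. Qed.

Lemma enumerates_next k b : consecutive S (g k) b -> g (k + 1) = b.
Proof. by apply: consecutive_fun; exact: enumerates_consecutive. Qed.

Lemma enumerates_prev k a : consecutive S a (g k) -> g (k - 1) = a.
Proof.
have := enumerates_consecutive (k - 1); rewrite subrK => /consecutive_inj.
exact.
Qed.

Lemma enumerates0 a b : consecutive S a b -> a <= 0 < b -> g 0 = a.
Proof.
case: gS => _ _; have [S0 S1 _ n01] := enumerates_consecutive 0.
move=> g01 [Sa Sb ab nab] ab0.
have [ga|ga|//] := ltgtP (g 0) a; exfalso.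
- by apply: (n01 a) => //; rewrite add0r; lia.
- by apply: (nab (g 0)) => //; lia.
Qed.

(** With [enumerates_exists], this identifies the event on which an enumeration exists, and so the
    one on which the default value is taken. *)
Lemma enumerates_unbounded : unbounded S.
Proof.
case: gS => gm gr g01.
have up n : g 0 + n%:Z <= g n%:Z.
  elim: n => [|n IH]; first by rewrite addr0.
  have : g n%:Z < g n.+1%:Z by apply: gm; lia.
  lia.
have down n : g (- n%:Z) <= g 0 - n%:Z.
  elim: n => [|n IH]; first by rewrite subr0.
  have : g (- n.+1%:Z) < g (- n%:Z) by apply: gm; lia.
  lia.
move=> m; split.
  exists (g (`|m - g 0|.+1)%:Z); first exact: enumerates_in.
  by have := up (`|m - g 0|.+1); lia.
exists (g (- (`|m - g 0|.+1)%:Z)); first exact: enumerates_in.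
by have := down (`|m - g 0|.+1); lia.
Qed.

End Enumerated.
End Enumeration.

(** * The product sigma-algebra on rows of connections *)

Section Events.
Variable R : realType.

(** [c i m] stands for the connection from [i] to [i + m + 1]. Indexing by offset instead of
    endpoint lets translations act on the first argument alone. *)
Definition config := int -> nat -> \bar R.

(** The sets [B e] are given at every coordinate, with [setT] off [J], so that intersections are
    coordinatewise and [J] may be enlarged freely. *)
Definition cylinder (K : set (int * nat)) : set (set config) :=
  [set A | exists (J : {fset int * nat}) (B : int * nat -> set (\bar R)),
    [/\ forall e, measurable (B e), forall e, e \in J -> K e,
        forall e, e \notin J -> B e = setT &
        A = [set c | forall e, B e (c e.1 e.2)]]].

(* An inductive wrapper, so that [event K A] does not unfold to a product. *)
Variant event (K : set (int * nat)) (A : set config) : Prop :=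
  Event of <<s cylinder K >> A.

Definition cfg_space := g_sigma_algebraType (cylinder setT).

Lemma cylinderT K : cylinder K setT.
Proof.
exists fset0, (fun=> setT); split=> //; apply/esym/seteqP; split=> // c _ e.
Qed.

Lemma cylinderI K : setI_closed (cylinder K).
Proof.
move=> _ _ [J [B [mB KJ BT ->]]] [J' [B' [mB' KJ' BT' ->]]].
exists (J `|` J')%fset, (fun e => B e `&` B' e); split.
- by move=> e; exact: measurableI.
- by move=> e; rewrite in_fsetU => /orP[/KJ|/KJ'].
- move=> e; rewrite in_fsetU negb_or => /andP[eJ eJ'].
  by rewrite BT // BT' // setIT.
- apply/seteqP; split=> c; first by move=> [Bc Bc'] e.
  by move=> Bc; split=> e; have [] := Bc e.
Qed.

Lemma cylinderS K K' : K `<=` K' -> cylinder K `<=` cylinder K'.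
Proof.
move=> KK' A [J [B [mB KJ BT ->]]]; exists J, B; split=> // e /KJ; exact: KK'.
Qed.

Lemma eventS K K' A : event K A -> K `<=` K' -> event K' A.
Proof.
move=> [eA] KK'; split=> C [sC KC]; apply: eA; split=> //.
by apply: subset_trans KC; exact: cylinderS.
Qed.

Lemma event_measurable K A :
  event K A -> measurable (A : set cfg_space).
Proof. by move=> /eventS/(_ (@subsetT _ K)) []. Qed.

Lemma event_coord K e (B : set (\bar R)) : K e -> measurable B ->
  event K [set c | B (c e.1 e.2)].
Proof.
move=> Ke mB; split; apply: sub_sigma_algebra.
exists [fset e]%fset, (fun e' => if e' == e then B else setT); split.
- by move=> e'; case: eqP.
- by move=> e'; rewrite inE => /eqP ->.
- by move=> e'; rewrite inE => /negbTE ->.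
- apply/seteqP; split=> c /=; first by move=> Bc e'; case: eqP => [->|].
  by move=> /(_ e); rewrite eqxx.
Qed.

Section EventLogic.
Variable K : set (int * nat).
Let M := g_sigma_algebraType (cylinder K).

Lemma event_not A : event K A -> event K [set c | ~ A c].
Proof. by move=> [mA]; split; exact: (@measurableC _ M). Qed.

Lemma event_and A B : event K A -> event K B -> event K [set c | A c /\ B c].
Proof. by move=> [mA] [mB]; split; exact: (@measurableI _ M). Qed.

Lemma event_exists (I : countType) (Q : I -> set config) :
  (forall i, event K (Q i)) -> event K [set c | exists i, Q i c].
Proof.
move=> mQ; have -> : [set c | exists i, Q i c] = \bigcup_i Q i.
  by apply/seteqP; split=> c [i]; exists i.
split; apply: (@countable_bigcupT_measurable _ M I Q (countableP _)) => i.
by have [] := mQ i.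
Qed.

Lemma event_forall (I : countType) (Q : I -> set config) :
  (forall i, event K (Q i)) -> event K [set c | forall i, Q i c].
Proof.
move=> mQ.
have -> : [set c | forall i, Q i c] = [set c | ~ exists i, ~ Q i c].
  apply/seteqP; split=> c /=; first by move=> H [i].
  by move=> H i; apply: contrapT => nQ; apply: H; exists i.
by apply: event_not; apply: event_exists => i; apply: event_not; exact: mQ.
Qed.

(** [C] does not involve the configuration. It is typically a bound on indices, which then serves to
    locate inside [K] the coordinates used by [A]. *)
Lemma event_guard (C : Prop) A :
  (C -> event K A) -> event K [set c | C -> A c].
Proof.
move=> mA; have [c|nc] := pselect C.
  have -> : [set c | C -> A c] = A by apply/seteqP; split=> x //= /(_ c).
  exact: mA.
have -> : [set c | C -> A c] = setT by apply/seteqP; split=> x // _ /nc.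
by split; exact: (@measurableT _ M).
Qed.

Lemma event_when (C : Prop) A :
  (C -> event K A) -> event K [set c | C /\ A c].
Proof.
move=> mA; have [c|nc] := pselect C.
  have -> : [set c | C /\ A c] = A by apply/seteqP; split=> x //= [].
  exact: mA.
have -> : [set c | C /\ A c] = set0 by apply/seteqP; split=> x // [/nc].
by split; exact: (@measurable0 _ M).
Qed.

End EventLogic.

Definition shift_rows (n : int) (c : config) : config := fun i => c (i + n).

(** All entries are independent; the law of an entry may depend on its offset [m] but not on its
    row. *)
Definition iid_rows (mu : set cfg_space -> \bar R) : Prop :=
  (forall (J : {fset int * nat}) (B : int * nat -> set (\bar R)),
    (forall e, measurable (B e)) -> (forall e, e \notin J -> B e = setT) ->
    mu [set c | forall e, B e (c e.1 e.2)] =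
    (\prod_(e <- J) mu [set c | B e (c e.1 e.2)])%E) /\
  forall i j m B, measurable B ->
    mu [set c | B (c i m)] = mu [set c | B (c j m)].

(** * Independence over disjoint coordinates and shift invariance *)

Section Product.
Variable mu : probability cfg_space R.
Hypothesis mu_iid : iid_rows mu.

Lemma cylinder_indep K K' A A' : K `&` K' = set0 ->
  cylinder K A -> cylinder K' A' -> mu (A `&` A') = (mu A * mu A')%E.
Proof.
move=> KK' [J [B [mB KJ BT ->]]] [J' [B' [mB' KJ' BT' ->]]].
have -> : [set c | forall e, B e (c e.1 e.2)] `&`
          [set c | forall e, B' e (c e.1 e.2)] =
          [set c : config | forall e, (B e `&` B' e) (c e.1 e.2)].
  apply/seteqP; split=> c; first by move=> [Bc Bc'] e.
  by move=> Bc; split=> e; have [] := Bc e.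
have [prodE _] := mu_iid.
have BT2 e : e \notin (J `|` J')%fset -> B e = setT /\ B' e = setT.
  by rewrite in_fsetU negb_or => /andP[/BT -> /BT' ->].
rewrite (prodE (J `|` J')%fset (fun e => B e `&` B' e)); first last.
- by move=> e /BT2[-> ->]; rewrite setIT.
- by move=> e; exact: measurableI.
rewrite (prodE (J `|` J')%fset B mB); last by move=> e /BT2[].
rewrite (prodE (J `|` J')%fset B' mB'); last by move=> e /BT2[].
rewrite -big_split /=; apply: eq_bigr => e _.
have muT : mu [set c | setT (c e.1 e.2)] = 1%E by exact: probability_setT.
have [eJ|/BT ->] := boolP (e \in J); last first.
  by rewrite muT mul1e; congr (mu _); apply/seteqP; split=> c /= => [[]|].
have [/KJ' K'e|/BT' ->] := boolP (e \in J').
  have : (K `&` K') e by split=> //; exact: KJ.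
  by rewrite KK'.
by rewrite muT mule1; congr (mu _); apply/seteqP; split=> c /= => [[]|].
Qed.

(** A pi-system argument made twice: the product formula passes from cylinders to the generated
    sigma-algebra one factor at a time, [key] keeping the other factor fixed. *)
Lemma event_indep K K' A A' : K `&` K' = set0 ->
  event K A -> event K' A' -> mu (A `&` A') = (mu A * mu A')%E.
Proof.
move=> KK'.
have key L' C : measurable (C : set cfg_space) ->
    (forall D, cylinder L' D -> mu (D `&` C) = (mu D * mu C)%E) ->
    forall D, <<s cylinder L' >> D -> mu (D `&` C) = (mu D * mu C)%E.
  move=> mC H D mD.
  have [r rE] : exists r : {nonneg R}, r%:num%:E = mu C.
    exists (NngNum (fine_ge0 (measure_ge0 mu C))).
    by rewrite /= fineK // fin_num_measure.
  (* For fixed [C] both sides are finite measures in [D]: [mu] restricted to [C], and [mu] scaled by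
     [mu C]. *)
  suff : mrestr mu mC D = mscale r mu D.
    by rewrite /mrestr /mscale /= rE muleC.
  apply: (@g_sigma_algebra_measure_unique _ R cfg_space (cylinder L') _
            (fun=> setT) _ _ (mrestr mu mC) (mscale r mu)) => //.
  - by move=> E cE; apply: (@event_measurable L'); split; exact: sub_sigma_algebra.
  - by move=> _; exact: cylinderT.
  - by rewrite bigcup_const.
  - exact: cylinderI.
  - move=> E /H HE; change (mu (E `&` C) = (r%:num%:E * mu E)%E).
    by rewrite rE HE muleC.
  - move=> _; change (mu (setT `&` C) < +oo)%E; rewrite setTI.
    by rewrite (le_lt_trans (probability_le1 _ mC)) // ltry.
move=> [sA] mA'; apply: (key K) => //; first exact: event_measurable mA'.
case: mA' => sA' D cD; rewrite setIC muleC; apply: (key K') => //.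
  by apply: (@event_measurable K); split; exact: sub_sigma_algebra.
by move=> D' cD'; rewrite setIC muleC; exact: cylinder_indep cD cD'.
Qed.

Lemma measurable_shift n :
  measurable_fun [set: cfg_space] (shift_rows n : cfg_space -> cfg_space).
Proof.
apply: (@measurability _ _ cfg_space cfg_space setT (shift_rows n) (cylinder setT) erefl).
move=> _ [A [J [B [mB KJ BT ->]]] <-]; rewrite setTI.
apply: (@event_measurable setT); apply: event_forall => e.
exact: (@event_coord setT (e.1 + n, e.2) (B e) I (mB e)).
Qed.

(** The image of [mu] under the shift agrees with [mu] on cylinders: [f] carries the finite
    coordinate set along, and the factors match because entries with one offset have the same law in
    all rows. *)
Lemma mu_shift n (A : set cfg_space) : measurable A -> mu (shift_rows n @^-1` A) = mu A.
Proof.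
move=> mA.
pose X : {mfun cfg_space >-> cfg_space} := mfun_Sub (mem_set (measurable_shift n)).
pose m1 : probability cfg_space R := distribution mu X.
change (m1 A = mu A).
apply: (@g_sigma_algebra_measure_unique _ R cfg_space (cylinder setT) _
   (fun=> setT) _ _ m1) => //.
- by move=> E /(@sub_sigma_algebra _ setT).
- by move=> _; exact: cylinderT.
- by rewrite bigcup_const.
- exact: cylinderI.
- move=> _ [J [B [mB KJ BT ->]]].
  change (mu (shift_rows n @^-1` [set c | forall e, B e (c e.1 e.2)]) =
          mu [set c | forall e, B e (c e.1 e.2)]).
  have [prodE lawE] := mu_iid.
  pose f (e : int * nat) := (e.1 + n, e.2).
  pose f' (e : int * nat) := (e.1 - n, e.2).
  have ff' : cancel f f' by move=> [i m]; rewrite /f /f' /= addrK.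
  have f'f : cancel f' f by move=> [i m]; rewrite /f /f' /= subrK.
  rewrite [RHS](prodE J) //.
  have -> : shift_rows n @^-1` [set c | forall e, B e (c e.1 e.2)] =
            [set c | forall e, B (f' e) (c e.1 e.2)].
    apply/seteqP; split=> c Bc e; last by have := Bc (f e); rewrite ff'.
    by have := Bc (f' e); rewrite /shift_rows /f' /= subrK.
  rewrite (prodE [fset f e | e in J]%fset (fun e => B (f' e))) //; last first.
    move=> e eJ; apply: BT; apply: contra eJ => eJ.
    by apply/imfsetP; exists (f' e).
  rewrite big_imfset /=; last by move=> x y _ _; exact: (can_inj ff').
  by apply: eq_bigr => e _; rewrite ff'; exact: lawE.
- move=> _; change (mu (shift_rows n @^-1` setT) < +oo)%E.
  by rewrite preimage_setT (le_lt_trans (probability_le1 _ measurableT)) // ltry.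
Qed.

End Product.
End Events.

(** * Events of the graph *)

Section Graph.
Variable R : realType.
Local Notation config := (config R).
Local Notation cfg_space := (cfg_space R).

Definition cedge (c : config) : rel int :=
  fun i j => (i < j) && (c i `|j - i|.-1 == 1%E).

Definition word (c : config) (a b : int) : fin_seq (nat_product (\bar R)) :=
  mkseq (fun m => c (a + m%:Z)) `|b - a|%N.

Definition rows (a b : int) : set (int * nat) := [set e | a <= e.1 < b].
Definition rows_from (a : int) : set (int * nat) := [set e | a <= e.1].
Definition rows_before (b : int) : set (int * nat) := [set e | e.1 < b].

Definition block (D : set (fin_seq (nat_product (\bar R)))) (a b : int) :
    set config :=
  [set c | cycle_block (cedge c) a b /\ D (word c a b)].

Lemma event_cedge K i j : K (i, `|j - i|.-1) ->
  event K [set c : config | cedge c i j].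
Proof.
move=> Kij; rewrite /cedge.
have -> : [set c : config | (i < j) && (c i `|j - i|.-1 == 1%E)] =
    [set c | i < j /\ [set x | x = 1%E] (c i `|j - i|.-1)].
  by apply/seteqP; split=> c /= => [/andP[? /eqP]|[-> ->]] //; rewrite eqxx.
apply: event_when => _.
exact: (@event_coord _ K (i, `|j - i|.-1) [set 1%E] Kij (emeasurable_set1 _)).
Qed.

Lemma event_rcov a b : event (rows a b) [set c : config | rcov (cedge c) a b].
Proof.
apply: event_forall => j; apply: event_guard => jab.
apply: event_exists => i; apply: event_when => aij.
by apply: event_cedge; rewrite /rows /=; lia.
Qed.

Lemma event_lcov a b : event (rows a b) [set c : config | lcov (cedge c) a b].
Proof.
apply: event_forall => j; apply: event_guard => jab.
apply: event_exists => i; apply: event_when => aij.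
by apply: event_cedge; rewrite /rows /=; lia.
Qed.

Lemma event_rinf a : event (rows_from a) [set c : config | rinf (cedge c) a].
Proof.
apply: event_forall => b; apply: (eventS (event_rcov a b)).
by move=> e; rewrite /rows /rows_from /=; lia.
Qed.

Lemma event_linf b : event (rows_before b) [set c : config | linf (cedge c) b].
Proof.
apply: event_forall => a; apply: (eventS (event_lcov a b)).
by move=> e; rewrite /rows /rows_before /=; lia.
Qed.

Lemma event_link a b : event (rows a b) [set c : config | link (cedge c) a b].
Proof. by apply: event_and; [exact: event_rcov|exact: event_lcov]. Qed.

Lemma event_cycle_block a b :
  event (rows a b) [set c : config | cycle_block (cedge c) a b].
Proof.
apply: event_and; first exact: event_link.
apply: event_forall => k; apply: event_guard => akb; apply: event_not.
apply: event_and.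
  by apply: (eventS (event_link a k)) => e; rewrite /rows /=; lia.
by apply: (eventS (event_link k b)) => e; rewrite /rows /=; lia.
Qed.

(** With [a] and [b] fixed the word has a fixed length, so only the trace of [D] on tuples of that
    length matters. *)
Lemma event_word K D a b :
  (forall i m : nat, (i < `|b - a|)%N -> K (a + i%:Z, m)) -> measurable D ->
  event K [set c | D (word c a b)].
Proof.
move=> Kab mD; pose M := g_sigma_algebraType (@cylinder R K).
pose row (i : int) (c : M) : nat_product (\bar R) := c i.
have mrow i : (forall m, K (i, m)) -> measurable_fun [set: M] (row i).
  move=> Ki; apply: (@measurability _ _ M _ setT (row i) _ erefl).
  move=> _ [A [m _ [B mB <-]] <-]; rewrite !setTI.
  by have [] := @event_coord _ K (i, m) B (Ki m) mB.
have mt : measurable_fun [set: M]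
    (fun c : M => [tuple row (a + i%:Z) c | i < `|b - a|%N]).
  apply/measurable_fun_tnthP => i.
  rewrite (_ : _ \o _ = row (a + i%:Z)); first by apply: mrow => m; exact: Kab.
  by apply/funext => c /=; rewrite tnth_mktuple.
split; have := mt measurableT _ (mD `|b - a|%N); rewrite setTI.
rewrite (_ : _ @^-1` _ = [set c | D (word c a b)]) //.
have wordE c : tval [tuple row (a + i%:Z) c | i < `|b - a|%N] = word c a b.
  by rewrite /word /mkseq -val_enum_ord -map_comp.
by apply/seteqP; split=> c /=; rewrite wordE.
Qed.

Lemma event_block D a b : a <= b -> measurable D -> event (rows a b) (block D a b).
Proof.
move=> ab mD; apply: event_and; first exact: event_cycle_block.
by apply: event_word => // i m; rewrite /rows /=; lia.
Qed.

Lemma cedge_shift n c i j : cedge (shift_rows n c) i j = cedge c (i + n) (j + n).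
Proof.
by rewrite /cedge /shift_rows ltrD2r (_ : j + n - (i + n) = j - i) //; lia.
Qed.

Lemma rcov_shift n c a b :
  rcov (cedge (shift_rows n c)) a b <-> rcov (cedge c) (a + n) (b + n).
Proof.
split=> H j jab.
  have [|i [ij eij]] := H (j - n); first by lia.
  by exists (i + n); rewrite cedge_shift subrK in eij; split=> //; lia.
have [|i [ij eij]] := H (j + n); first by lia.
by exists (i - n); rewrite cedge_shift subrK; split=> //; lia.
Qed.

Lemma lcov_shift n c a b :
  lcov (cedge (shift_rows n c)) a b <-> lcov (cedge c) (a + n) (b + n).
Proof.
split=> H j jab.
  have [|i [ij eij]] := H (j - n); first by lia.
  by exists (i + n); rewrite cedge_shift subrK in eij; split=> //; lia.
have [|i [ij eij]] := H (j + n); first by lia.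
by exists (i - n); rewrite cedge_shift subrK; split=> //; lia.
Qed.

Lemma rinf_shift n c a : rinf (cedge (shift_rows n c)) a <-> rinf (cedge c) (a + n).
Proof.
split=> H b; last exact/rcov_shift/H.
by rewrite -(subrK n b); exact/rcov_shift/H.
Qed.

Lemma linf_shift n c a : linf (cedge (shift_rows n c)) a <-> linf (cedge c) (a + n).
Proof.
split=> H b; last exact/lcov_shift/H.
by rewrite -(subrK n b); exact/lcov_shift/H.
Qed.

Lemma link_shift n c a b :
  link (cedge (shift_rows n c)) a b <-> link (cedge c) (a + n) (b + n).
Proof.
by split=> -[r l]; split; (exact/rcov_shift || exact/lcov_shift).
Qed.

Lemma cycle_block_shift n c a b :
  cycle_block (cedge (shift_rows n c)) a b <-> cycle_block (cedge c) (a + n) (b + n).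
Proof.
split=> -[l H]; (split; last move=> k kab [lk kl]).
- exact/link_shift.
- apply: (H (k - n)); first by lia.
  by split; apply/link_shift; rewrite subrK.
- exact/link_shift.
- by apply: (H (k + n)); [lia|split; exact/link_shift].
Qed.

Lemma word_shift n c a b : word (shift_rows n c) a b = word c (a + n) (b + n).
Proof.
rewrite /word (_ : b + n - (a + n) = b - a); last by lia.
by apply: eq_map => m; rewrite /shift_rows addrAC.
Qed.

Lemma block_shift n D a b : shift_rows n @^-1` block D a b = block D (a + n) (b + n).
Proof.
apply/seteqP; split=> c /=.
  by move=> [/cycle_block_shift ? ]; rewrite word_shift.
by move=> [? ?]; split; [exact/cycle_block_shift|rewrite word_shift].
Qed.

End Graph.

(** * Positive probability of leading to everything *)

Section Positivity.
Variables (R : realType) (mu : probability (cfg_space R) R) (p : nat -> R).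
Hypothesis mu_iid : iid_rows mu.
Hypothesis mu_p : forall i m, mu [set c | c i m = 1%E] = (p m.+1)%:E.
Hypothesis p_ge0 : forall j, (1 <= j)%N -> 0 <= p j < 1.
Hypothesis p1_gt0 : 0 < p 1%N.
Hypothesis p_sum :
  (\sum_(1 <= k <oo) (\prod_(1 <= j < k.+1) (1 - p j))%:E < +oo)%E.

Lemma event_indep_family n (f : nat -> int * nat) (B : nat -> set (\bar R)) :
  {in [pred i | (i < n)%N] &, injective f} -> (forall i, measurable (B i)) ->
  event [set f i | i in [set i | (i < n)%N]]
    [set c | forall i, (i < n)%N -> B i (c (f i).1 (f i).2)] /\
  mu [set c | forall i, (i < n)%N -> B i (c (f i).1 (f i).2)] =
  (\prod_(i < n) mu [set c | B i (c (f i).1 (f i).2)])%E.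
Proof.
move=> + mB; elim: n => [|n IH] finj.
  rewrite big_ord0 (_ : [set c : config R | _] = setT); last first.
    by apply/seteqP; split=> [//|c _ i].
  by rewrite probability_setT; split=> //; split;
    exact: (@measurableT _ (g_sigma_algebraType (cylinder _))).
have [|e E] := IH.
  by move=> i j; rewrite !inE => ni nj; apply: finj; rewrite inE leqW.
have -> : [set c : config R | forall i, (i < n.+1)%N -> B i (c (f i).1 (f i).2)] =
   [set c | forall i, (i < n)%N -> B i (c (f i).1 (f i).2)] `&`
   [set c | B n (c (f n).1 (f n).2)].
  apply/seteqP; split=> c /=.
    by move=> H; split=> [i ni|]; apply: H => //; exact: leqW.
  by move=> [H Hn] i; rewrite ltnS leq_eqVlt => /predU1P[->|/H].
have en : event [set f n] [set c | B n (c (f n).1 (f n).2)].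
  exact: event_coord.
split.
  apply: event_and.
    apply: (eventS e) => _ [i /= ni <-]; exists i => //=; exact: ltnW.
  by apply: (eventS en) => _ ->; exists n => /=.
rewrite big_ord_recr /= -E; apply: (event_indep mu_iid _ e en).
apply/seteqP; split=> // x [[i /= ni <-] fin].
have := finj i n; rewrite !inE leqW // => /(_ isT (ltnSn n) fin) iE.
by rewrite iE ltnn in ni.
Qed.

Let q (j : nat) := \prod_(1 <= i < j.+2) (1 - p i).

(** The coordinates [(t k, k)] are distinct whatever [t] is, as their offsets differ. One statement
    thus serves in-edges, whose source varies with [k], and out-edges, whose source is constant. *)
Lemma miss_prob j (t : nat -> int) :
  mu [set c | forall k, (k <= j)%N -> c (t k) k <> 1%E] = (q j)%:E.
Proof.
have [] := @event_indep_family j.+1 (fun k => (t k, k)) (fun=> ~` [set 1%E]).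
- by move=> k k' _ _ [].
- by move=> _; apply: measurableC.
move=> _ -> /=; rewrite /q big_add1 /= big_mkord -prodEFin; apply: eq_bigr => k _.
have -> : [set c : config R | (~` [set 1%E]) (c (t k) k)] =
          ~` [set c | c (t k) k = 1%E] by [].
rewrite probability_setC ?mu_p ?EFinB //.
have := @event_coord R setT (t k, k : nat) [set 1%E] I (emeasurable_set1 _).
exact: event_measurable.
Qed.

(** A union bound over the misses covers all [j >= N] with positive probability (event [B]); edges
    of length one cover the finitely many [j < N] (event [A]). Injectivity of [t] in [j] keeps the
    coordinates of [A] away from those of [B], so the two are independent. *)
Lemma cover_gt0 (t : nat -> nat -> int) :
  (forall j j' k, t j k = t j' k -> j = j') ->
  (0 < mu [set c | forall j, exists k, (k <= j)%N /\ c (t j k) k = 1%E])%E.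
Proof.
move=> tinj.
have q_ge0 j : 0 <= q j.
  rewrite /q big_nat_cond; apply: prodr_ge0 => i /andP[/andP[i1 _] _].
  by rewrite subr_ge0; case/andP: (p_ge0 i1) => _ /ltW.
have [N qN] : exists N, (\sum_(N <= j <oo) (q j)%:E < 1)%E.
  have qsum : (\sum_(0 <= j <oo) (q j)%:E < +oo)%E.
    pose F k := (\prod_(1 <= i < k.+1) (1 - p i))%:E.
    have F_ge0 k : (0 <= F k)%E.
      by case: k => [|k]; rewrite lee_fin ?q_ge0 // big_geq.
    move: p_sum; rewrite -(nneseries_addn 1 F_ge0); congr (_ < _)%E.
    by apply: eq_eseriesr => j _; rewrite addn1.
  have q0 j : xpredT j -> (0 <= (q j)%:E)%E by rewrite lee_fin q_ge0.
  have /(_ [set x | (x < 1)%E]) [|N _ /(_ N) HN] := nneseries_tail_cvg qsum q0.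
    by apply: open_nbhs_nbhs; split; [exact: open_ereal_lt_ereal|exact: lte01].
  by exists N; apply: HN => /=.
pose A := [set c : config R | forall j, (j < N)%N -> [set 1%E] (c (t j 0%N) 0%N)].
pose B := [set c : config R |
  forall j, (N <= j)%N -> exists k, (k <= j)%N /\ c (t j k) k = 1%E].
have [|//|eA muA] := @event_indep_family N (fun j => (t j 0%N, 0%N)) (fun=> [set 1%E]).
  by move=> j j' _ _ [/tinj].
have eB : event [set e | forall j, (j < N)%N -> e != (t j 0%N, 0%N)] B.
  apply: event_forall => j; apply: event_guard => Nj.
  apply: event_exists => k; apply: event_when => kj.
  apply: (@event_coord _ _ (t j k, k) [set 1%E] _ (emeasurable_set1 _)) => j' j'N.
  apply/eqP => -[+ k0]; rewrite k0 => /tinj jj'.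
  by move: j'N; rewrite -jj' ltnNge Nj.
apply: (@lt_le_trans _ _ (mu (A `&` B))); last first.
  apply: le_measure; rewrite ?inE.
  - by apply: measurableI; [exact: event_measurable eA|exact: event_measurable eB].
  - apply: (@event_measurable _ setT); apply: event_forall => j.
    apply: event_exists => k; apply: event_when => kj.
    exact: (@event_coord _ _ (t j k, k) [set 1%E] I (emeasurable_set1 _)).
  - move=> c [Ac Bc] j; have [jN|Nj] := ltnP j N; last exact: Bc.
    by exists 0%N; split=> //; exact: Ac.
rewrite (event_indep mu_iid _ eA eB); last first.
  by apply/seteqP; split=> // _ [[j /= jN <-] /(_ _ jN)]; rewrite eqxx.
apply: mule_gt0.
  rewrite muA; apply: (big_ind (fun x => 0 < x)%E) => //; first exact: mule_gt0.
  by move=> j _; rewrite mu_p lte_fin.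
have mB := event_measurable eB.
have : (mu (~` B) < 1)%E.
  apply: le_lt_trans qN.
  rewrite (eq_eseriesr (g := fun j =>
    mu [set c | forall k, (k <= j)%N -> c (t j k) k <> 1%E])); last first.
    by move=> j _; rewrite miss_prob.
  apply: measure_sigma_subadditive_tail.
  - move=> j; apply: (@event_measurable _ setT); apply: event_forall => k.
    apply: event_guard => kj; apply: event_not.
    exact: (@event_coord _ _ (t j k, k) [set 1%E] I (emeasurable_set1 _)).
  - exact: measurableC.
  - move=> c nB; apply: contrapT => H; apply: nB => j Nj.
    apply: contrapT => nk; apply: H; exists j; first by rewrite /= ltnNge Nj.
    by move=> k kj ck; apply: nk; exists k.
rewrite probability_setC // => muB; rewrite lt0e measure_ge0 andbT.
by apply/eqP => B0; move: muB; rewrite B0 sube0 ltxx.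
Qed.

End Positivity.

(** * Second moment bound *)

Section SecondMoment.
Context d (T : measurableType d) (R : realType) (P : probability T R).

(** Linearity and monotonicity of the integral, packaged so that the second moment computation runs
    on weights and sets alone. *)
Lemma weighted_measure_le (s s' : seq (R * set T)) :
  (forall x, x \in s ++ s' -> 0 <= x.1 /\ measurable x.2) ->
  (forall w, \sum_(x <- s) x.1 * \1_(x.2) w <= \sum_(x <- s') x.1 * \1_(x.2) w) ->
  (\sum_(x <- s) x.1%:E * P x.2 <= \sum_(x <- s') x.1%:E * P x.2)%E.
Proof.
move=> H le_ss'.
have key (r : seq (R * set T)) :
    (forall x, x \in r -> 0 <= x.1 /\ measurable x.2) ->
    [/\ forall w, 0 <= \sum_(x <- r) x.1 * \1_(x.2) w,
        measurable_fun setT (fun w => \sum_(x <- r) x.1 * \1_(x.2) w) &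
        (\int[P]_w (\sum_(x <- r) x.1 * \1_(x.2) w)%:E =
         \sum_(x <- r) x.1%:E * P x.2)%E].
  elim: r => [_|[k A] r IH Hr].
    split; [by move=> w; rewrite big_nil| |].
      by under eq_fun do rewrite big_nil; exact: measurable_cst.
    by under eq_integral do rewrite big_nil; rewrite integral0 big_nil.
  have [|r0 mr rE] := IH; first by move=> x xr; apply: Hr; rewrite inE xr orbT.
  have [/= k0 mA] := Hr _ (mem_head _ _).
  have mkA : measurable_fun setT (fun w => k * \1_A w : R).
    by apply: measurable_funM => //; exact: measurable_indic.
  have kA0 w : 0 <= k * \1_A w :> R by rewrite mulr_ge0.
  split.
  - by move=> w; rewrite big_cons addr_ge0.
  - by under eq_fun do rewrite big_cons; exact: measurable_funD.
  - under eq_integral do rewrite big_cons EFinD.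
    rewrite ge0_integralD //; try (exact/measurable_EFinP).
    rewrite rE big_cons; congr (_ + _)%E.
    under eq_integral do rewrite EFinM.
    rewrite ge0_integralZl_EFin //; first by rewrite integral_indic // setIT.
    by apply/measurable_EFinP; exact: measurable_indic.
    by move=> w _; rewrite lee_fin.
    by move=> w _; rewrite lee_fin.
have [|s0 ms <-] := key s; first by move=> x xs; apply: H; rewrite mem_cat xs.
have [|s'0 ms' <-] := key s'.
  by move=> x xs; apply: H; rewrite mem_cat xs orbT.
apply: ge0_le_integral => //; try (exact/measurable_EFinP).
- by move=> w _; rewrite lee_fin.
- by move=> w _; rewrite lee_fin.
Qed.

(** Chebyshev at 0 for the number [X] of events [E i], [i < n], that occur, with mean [m = n s].
    Pointwise [m^2 1_Z + 2 m X <= X^2 + m^2]: an equality on [Z], where [X = 0], and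
    [(X - m)^2 >= 0] elsewhere. Integrating gives the bound. *)
Lemma second_moment_bound (n : nat) (E : nat -> set T) (s b : R) :
  0 <= s -> 0 <= b -> (forall i, measurable (E i)) ->
  (forall i, P (E i) = s%:E) ->
  (forall i j, i <> j -> (P (E i `&` E j) <= b%:E)%E) ->
  (((n%:R * s) ^+ 2)%:E * P [set w | forall i, (i < n)%N -> ~ E i w] +
     ((n%:R * s) ^+ 2)%:E <= (n%:R * s + n%:R ^+ 2 * b)%:E)%E.
Proof.
move=> s0 b0 mE Es Eb; set Z := [set w | _]; set m := n%:R * s.
have m0 : 0 <= m by rewrite mulr_ge0.
have mZ : measurable Z.
  rewrite (_ : Z = \bigcap_(i in [set i | (i < n)%N]) ~` E i) //.
  by apply: bigcap_measurableType => i _; exact: measurableC.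
pose l := (m ^+ 2, Z) :: [seq (2 * m, E i) | i <- iota 0 n].
pose r := (m ^+ 2, setT) ::
  [seq (1, E i `&` E j) | i <- iota 0 n, j <- iota 0 n].
have lr_ok x : x \in l ++ r -> 0 <= x.1 /\ measurable x.2.
  rewrite mem_cat !inE -!orbA.
  move=> /or4P[/eqP->|/mapP[i _ ->]|/eqP->|/allpairsP[ij [_ _ ->]]] /=.
  - by rewrite sqr_ge0.
  - by rewrite mulr_ge0.
  - by rewrite sqr_ge0.
  - by split=> //; exact: measurableI.
have le_lr w : \sum_(x <- l) x.1 * \1_(x.2) w <= \sum_(x <- r) x.1 * \1_(x.2) w.
  rewrite /l /r !big_cons !big_map big_allpairs_dep /=.
  pose X := \sum_(i <- iota 0 n) \1_(E i) w : R.
  have -> : \sum_(i <- iota 0 n) 2 * m * \1_(E i) w = 2 * m * X.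
    by rewrite mulr_sumr.
  have -> : \sum_(i <- iota 0 n) \sum_(j <- iota 0 n) 1 * \1_(E i `&` E j) w = X ^+ 2.
    rewrite expr2 mulr_suml; apply: eq_bigr => i _; rewrite mulr_sumr.
    by apply: eq_bigr => j _; rewrite mul1r indicI.
  rewrite indicT mulr1.
  have [Zw|Zw] := boolP (w \in Z).
    suff -> : X = 0 by rewrite mulr0 expr0n /= indicE Zw mulr1.
    rewrite /X big_seq big1 // => i; rewrite mem_iota add0n => /andP[_ ni].
    by rewrite indicE memNset //; move: Zw; rewrite inE => /(_ _ ni).
  by rewrite indicE (negbTE Zw) mulr0 add0r; have := sqr_ge0 (X - m); nra.
have := weighted_measure_le lr_ok le_lr.
rewrite /l /r !big_cons !big_map big_allpairs_dep /= => le_int.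
have P1 : P setT = 1%E by exact: probability_setT.
have sumE : (\sum_(i <- iota 0 n) (2 * m)%:E * P (E i) = (2 * m ^+ 2)%:E)%E.
  under eq_bigr do rewrite Es -EFinM.
  rewrite sumEFin big_const_seq count_predT size_iota iter_addr_0 -mulr_natl.
  by congr EFin; rewrite /m; ring.
have sum2E : (\sum_(i <- iota 0 n) \sum_(j <- iota 0 n) 1%:E * P (E i `&` E j) <=
   (n%:R * s + n%:R ^+ 2 * b)%:E)%E.
  (* For each [i] the diagonal term is [s] and the others are at most [b]; [n b] counts one [b] too
     many, harmless as [0 <= b]. *)
  apply: (@le_trans _ _ (\sum_(i <- iota 0 n) (s + n%:R * b)%:E)%E); last first.
    rewrite sumEFin big_const_seq count_predT size_iota iter_addr_0 -mulr_natl.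
    by rewrite lee_fin le_eqVlt; apply/orP; left; apply/eqP; ring.
  rewrite big_seq [leRHS]big_seq; apply: lee_sum => i i_n.
  rewrite (bigD1_seq i) ?iota_uniq //= setIid mul1e Es EFinD leeD2l //.
  apply: (@le_trans _ _ (\sum_(j <- iota 0 n) b%:E)%E); last first.
    rewrite sumEFin big_const_seq count_predT size_iota iter_addr_0.
    by rewrite mulr_natl.
  rewrite [leRHS](bigD1_seq i) ?iota_uniq //= -[leLHS]add0e leeD ?lee_fin //.
  by apply: lee_sum => j ji; rewrite mul1e; apply: Eb => ij; rewrite ij eqxx in ji.
move: le_int; rewrite sumE P1 mule1.
move=> /le_trans/(_ (leeD (lexx _) sum2E)).
have : P Z \is a fin_num by exact: fin_num_measure.
case: (P Z) => // z _; rewrite -!EFinM -!EFinD !lee_fin /m; lra.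
Qed.

End SecondMoment.

(** * Unboundedness of the skeleton *)

Section PositivityCover.
Variables (R : realType) (mu : probability (cfg_space R) R) (p : nat -> R).
Hypothesis mu_iid : iid_rows mu.
Hypothesis mu_p : forall i m, mu [set c | c i m = 1%E] = (p m.+1)%:E.
Hypothesis p_ge0 : forall j, (1 <= j)%N -> 0 <= p j < 1.
Hypothesis p1_gt0 : 0 < p 1%N.
Hypothesis p_sum :
  (\sum_(1 <= k <oo) (\prod_(1 <= j < k.+1) (1 - p j))%:E < +oo)%E.

Lemma measurable_cover (t : nat -> nat -> int) : measurable
  ([set c | forall j, exists k, (k <= j)%N /\ c (t j k) k = 1%E] : set (cfg_space R)).
Proof.
apply: (@event_measurable _ setT); apply: event_forall => j.
apply: event_exists => k; apply: event_when => kj.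
exact: (@event_coord _ _ (t j k, k) [set 1%E] I (emeasurable_set1 _)).
Qed.

Lemma rinf0_gt0 : (0 < mu [set c | rinf (cedge c) 0])%E.
Proof.
(* The edge of length [k + 1] into vertex [j + 1] comes from [j - k], and [k <= j] keeps this source
   at or after 0. *)
have := cover_gt0 mu_iid mu_p p_ge0 p1_gt0 p_sum (t := fun j k => j%:Z - k%:Z).
move/(_ _)/lt_le_trans; apply; first by move=> j j' k /addIr [].
apply: le_measure; rewrite ?inE; first exact: measurable_cover.
  exact: event_measurable (event_rinf R 0).
move=> c H b j /andP[j0 jb]; have [k [kj ck]] := H `|j|.-1.
exists (`|j|.-1%:Z - k%:Z); split; first by lia.
apply/andP; split; first by lia.
by rewrite (_ : `|j - _|.-1 = k) ?ck //; lia.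
Qed.

Lemma linf0_gt0 : (0 < mu [set c | linf (cedge c) 0])%E.
Proof.
(* Vertex [- (j + 1)] sends its edge of length [k + 1] to [k - j], which is at most 0 when [k <= j];
   the row is the same for all [k]. *)
have := cover_gt0 mu_iid mu_p p_ge0 p1_gt0 p_sum (t := fun j k => - j.+1%:Z).
move/(_ _)/lt_le_trans; apply; first by move=> j j' k /oppr_inj [].
apply: le_measure; rewrite ?inE; first exact: measurable_cover.
  exact: event_measurable (event_linf R 0).
move=> c H b j /andP[jb j0]; have [k [kj ck]] := H `|j|.-1.
exists (j + k.+1%:Z); split; first by lia.
apply/andP; split; first by lia.
have jE : - `|j|.-1.+1%:Z = j by lia.
by rewrite jE in ck; rewrite (_ : `|_ - j|.-1 = k) ?ck //; lia.
Qed.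

End PositivityCover.

Section Skeleton.
Variable R : realType.

Definition skel (c : config R) : set int :=
  [set n | linf (cedge c) n /\ rinf (cedge c) n].

Lemma event_skel n : event setT [set c : config R | skel c n].
Proof.
by apply: event_and; [exact: eventS (event_linf R n) (@subsetT _ _)|
                       exact: eventS (event_rinf R n) (@subsetT _ _)].
Qed.

Lemma event_unbounded : event setT [set c : config R | unbounded (skel c)].
Proof.
have ev (C : int -> Prop) : event setT [set c : config R | exists2 n, skel c n & C n].
  rewrite (_ : mkset _ = [set c | exists n, C n /\ skel c n]).
    by apply: event_exists => n; apply: event_when => _; exact: event_skel.
  by apply/seteqP; split=> c [n]; [exists n|case; exists n].
by apply: event_forall => m; apply: event_and; exact: ev.
Qed.

End Skeleton.

(** * Density and decorrelation of skeleton vertices *)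

Section Regeneration.
Variables (R : realType) (mu : probability (cfg_space R) R).
Hypothesis mu_iid : iid_rows mu.
Hypothesis rinf_gt0 : (0 < mu [set c | rinf (cedge c) 0])%E.
Hypothesis linf_gt0 : (0 < mu [set c | linf (cedge c) 0])%E.

Lemma mu_rinf a : mu [set c | rinf (cedge c) a] = mu [set c | rinf (cedge c) 0].
Proof.
rewrite -(mu_shift mu_iid a (event_measurable (@event_rinf R 0))).
congr (mu _); apply/seteqP; split=> c /= H; first by apply/rinf_shift; rewrite add0r.
by move/rinf_shift: H; rewrite add0r.
Qed.

Lemma mu_linf a : mu [set c | linf (cedge c) a] = mu [set c | linf (cedge c) 0].
Proof.
rewrite -(mu_shift mu_iid a (event_measurable (@event_linf R 0))).
congr (mu _); apply/seteqP; split=> c /= H; first by apply/linf_shift; rewrite add0r.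
by move/linf_shift: H; rewrite add0r.
Qed.

Lemma mu_rcov a t :
  mu [set c | rcov (cedge c) a (a + t)] = mu [set c | rcov (cedge c) 0 t].
Proof.
rewrite -(mu_shift mu_iid a (event_measurable (@event_rcov R 0 t))).
congr (mu _); apply/seteqP; split=> c /= H; first by apply/rcov_shift; rewrite add0r addrC.
by move/rcov_shift: H; rewrite add0r addrC.
Qed.

Lemma mu_lcov b t :
  mu [set c | lcov (cedge c) (b - t) b] = mu [set c | lcov (cedge c) (- t) 0].
Proof.
rewrite -(mu_shift mu_iid b (event_measurable (@event_lcov R (- t) 0))).
congr (mu _); apply/seteqP; split=> c /= H; first by apply/lcov_shift; rewrite add0r addrC.
by move/lcov_shift: H; rewrite add0r addrC.
Qed.

Lemma mu_skel n : mu [set c | skel c n] =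
  (mu [set c | linf (cedge c) 0] * mu [set c | rinf (cedge c) 0])%E.
Proof.
rewrite -(mu_linf n) -(mu_rinf n).
apply: (event_indep mu_iid _ (event_linf R n) (event_rinf R n)).
by apply/seteqP; split=> // e; rewrite /rows_before /rows_from /=; lia.
Qed.

(** Weakening [rinf] at [x] to the next [t] vertices and [linf] at [y] to the previous [t] leaves
    four conditions on disjoint sets of rows. *)
Lemma mu_skel2_le (t : nat) x y : x + t%:Z <= y - t%:Z ->
  (mu ([set c | skel c x] `&` [set c | skel c y]) <=
   (mu [set c | linf (cedge c) 0] * mu [set c | rcov (cedge c) 0 t%:Z]) *
   (mu [set c | lcov (cedge c) (- t%:Z) 0] * mu [set c | rinf (cedge c) 0]))%E.
Proof.
move=> xy; pose z := x + t%:Z.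
have e1 : event (rows_before z)
    [set c : config R | linf (cedge c) x /\ rcov (cedge c) x (x + t%:Z)].
  apply: event_and; [apply: eventS (event_linf R x) _|apply: eventS (event_rcov R _ _) _];
    by move=> e; rewrite /rows_before /rows /z /=; lia.
have e2 : event (rows_from z)
    [set c : config R | lcov (cedge c) (y - t%:Z) y /\ rinf (cedge c) y].
  apply: event_and; [apply: eventS (event_lcov R _ _) _|apply: eventS (event_rinf R y) _];
    by move=> e; rewrite /rows_from /rows /z /=; lia.
rewrite -(mu_linf x) -(mu_rinf y) -(mu_rcov x) -(mu_lcov y).
rewrite -(event_indep mu_iid _ (event_linf R x) (event_rcov R x _)); last first.
  by apply/seteqP; split=> // e; rewrite /rows_before /rows /=; lia.
rewrite -(event_indep mu_iid _ (event_lcov R _ y) (event_rinf R y)); last first.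
  by apply/seteqP; split=> // e; rewrite /rows_from /rows /=; lia.
rewrite -(event_indep mu_iid _ e1 e2); last first.
  by apply/seteqP; split=> // e; rewrite /rows_before /rows_from /=; lia.
apply: le_measure; rewrite ?inE.
- apply: measurableI; exact: event_measurable (event_skel R _).
- by apply: measurableI; [exact: event_measurable e1|exact: event_measurable e2].
- by move=> c [[lx rx] [ly ry]]; do !split=> //.
Qed.

Let s := fine (mu [set c | linf (cedge c) 0] * mu [set c | rinf (cedge c) 0]).

Lemma skel_probE :
  (mu [set c | linf (cedge c) 0] * mu [set c | rinf (cedge c) 0])%E = s%:E.
Proof.
rewrite /s fineK // fin_numM // fin_num_measure //.
  exact: event_measurable (event_linf R 0).
exact: event_measurable (event_rinf R 0).
Qed.

Lemma skel_prob_gt0 : 0 < s.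
Proof. by rewrite -lte_fin -skel_probE mule_gt0. Qed.

(** As [t] grows, the truncated probabilities decrease to those of [rinf] and [linf], so the bound
    of [mu_skel2_le] tends to [s ^+ 2]. A distance [2 N] leaves room for [N] rows at each vertex. *)
Lemma skel_decorrelation (eps : R) : 0 < eps ->
  exists h : nat, forall x y, x + h%:Z <= y ->
  (mu ([set c | skel c x] `&` [set c | skel c y]) <= (s ^+ 2 + eps)%:E)%E.
Proof.
move=> eps0.
have mr (t : nat) := event_measurable (@event_rcov R 0 t%:Z).
have ml (t : nat) := event_measurable (@event_lcov R (- t%:Z) 0).
have mri := event_measurable (@event_rinf R 0).
have mli := event_measurable (@event_linf R 0).
have fin (A : set (cfg_space R)) : measurable A -> mu A \is a fin_num.
  by move=> mA; exact: fin_num_measure.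
have rE : \bigcap_t [set c : config R | rcov (cedge c) 0 (t : nat)%:Z] =
          [set c | rinf (cedge c) 0].
  apply/seteqP; split=> c H; last by move=> t _; exact: H.
  by move=> b j jb; apply: (H `|b|%N I j); lia.
have lE : \bigcap_t [set c : config R | lcov (cedge c) (- (t : nat)%:Z) 0] =
          [set c | linf (cedge c) 0].
  apply/seteqP; split=> c H; last by move=> t _; exact: H.
  by move=> b j jb; apply: (H `|b|%N I j); lia.
have cr : (fun t : nat => mu [set c | rcov (cedge c) 0 t%:Z]) @ \oo -->
          mu [set c | rinf (cedge c) 0].
  rewrite -rE; apply: nonincreasing_cvg_mu => //.
  - by rewrite ltey_eq fin.
  - by rewrite rE.
  - by move=> m n mn; apply/subsetPset => c H j jm; apply: H; lia.
have cl : (fun t : nat => mu [set c | lcov (cedge c) (- t%:Z) 0]) @ \oo -->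
          mu [set c | linf (cedge c) 0].
  rewrite -lE; apply: nonincreasing_cvg_mu => //.
  - by rewrite ltey_eq fin.
  - by rewrite lE.
  - by move=> m n mn; apply/subsetPset => c H j jm; apply: H; lia.
have cvg := cvgeM _ (cvgeZl (fin _ mli) cr) (cvgeZr (fin _ mri) cl).
have [||N _ /(_ N) HN] := cvg _ _ [set x | (x < (s ^+ 2 + eps)%:E)%E].
- by rewrite !skel_probE mule_def_fin.
- apply: open_nbhs_nbhs; split; first exact: open_ereal_lt_ereal.
  by rewrite /= skel_probE -EFinM lte_fin expr2 ltrDl.
exists (2 * N)%N => x y xy; apply: (le_trans (mu_skel2_le (t := N) _)); first by lia.
by apply: ltW; apply: HN => /=.
Qed.

(** The spacing [h] is chosen after the supposed positive value [z] of the probability; hence a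
    family of sequences, one for each [h], all of which are missed on [Z]. *)
Lemma skel_misses_null (f : nat -> nat -> int) :
  (forall h i j, i <> j -> (h <= `|f h i - f h j|)%N) ->
  mu [set c | forall h i, ~ skel c (f h i)] = 0%E.
Proof.
move=> fsep; set Z := [set c | _].
have mZ : measurable (Z : set (cfg_space R)).
  apply: (@event_measurable _ setT); apply: event_forall => h.
  by apply: event_forall => i; apply: event_not; exact: event_skel.
have [z zE] : exists z, mu Z = z%:E.
  by exists (fine (mu Z)); rewrite fineK // fin_num_measure.
have : 0 <= z by rewrite -lee_fin -zE; exact: measure_ge0.
rewrite le_eqVlt zE => /predU1P[<- //|z0]; exfalso.
have s0 := skel_prob_gt0.
(* With [m = n s], the second moment bound will read [m^2 z <= m + m^2 z / 4]; the choice of [n]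
   gives [m z > 2], hence [m < m^2 z / 2], a contradiction. *)
have eps0 : 0 < s ^+ 2 * z / 4 by rewrite divr_gt0 // mulr_gt0 // exprn_gt0.
have [h H] := skel_decorrelation eps0.
pose E i := [set c : config R | skel c (f h i)].
have mE i : measurable (E i : set (cfg_space R)).
  by exact: event_measurable (event_skel R _).
have Es i : mu (E i) = s%:E by rewrite mu_skel skel_probE.
have Eb i j : i <> j -> (mu (E i `&` E j) <= (s ^+ 2 + s ^+ 2 * z / 4)%:E)%E.
  move=> /(fsep h) hij; have [fij|fji] := leP (f h i) (f h j).
    by apply: H; lia.
  by rewrite setIC; apply: H; lia.
pose n := (Num.truncn (2 / (s * z))).+1.
have nP : 2 / (s * z) < n%:R by exact: truncnS_gt.
have := second_moment_bound n (ltW s0) (ltW (addr_gt0 (exprn_gt0 2 s0) eps0)) mE Es Eb.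
apply/negP; rewrite -ltNge.
apply: (@lt_le_trans _ _ (((n%:R * s) ^+ 2)%:E * z%:E + ((n%:R * s) ^+ 2)%:E)%E); last first.
  rewrite leeD2r // -zE lee_wpmul2l ?lee_fin ?sqr_ge0 //.
  apply: le_measure; rewrite ?inE //.
    rewrite (_ : mkset _ = \bigcap_(i in [set i | (i < n)%N]) ~` E i) //.
    by apply: bigcap_measurableType => i _; exact: measurableC.
  by move=> c Zc i _; exact: Zc.
rewrite -EFinM -EFinD lte_fin.
have n0 : 0 < n%:R :> R by rewrite ltr0n.
rewrite ltr_pdivrMr ?mulr_gt0 // in nP.
have : n%:R * s * 2 < n%:R * s * (n%:R * (s * z)) by rewrite ltr_pM2l // mulr_gt0.
nra.
Qed.

Lemma unbounded_ae : mu [set c | ~ unbounded (skel c)] = 0%E.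
Proof.
(* For fixed [n] and [h] these are vertices to the right of [n] with gap [h]; their negatives lie to
   the left of [- n]. *)
pose up n h i : int := n%:Z + (1 + i * h)%N%:Z.
pose Z (f : nat -> nat -> int) := [set c : config R | forall h i, ~ skel c (f h i)].
have mZ f : measurable (Z f : set (cfg_space R)).
  apply: (@event_measurable _ setT); apply: event_forall => h.
  by apply: event_forall => i; apply: event_not; exact: event_skel.
have nZ f : (forall h i j, i <> j -> (h <= `|f h i - f h j|)%N) ->
    mu.-negligible (Z f).
  by move=> fsep; apply/negligibleP => //; exact: skel_misses_null.
have updist (h i j : nat) : i <> j -> (h <= `|(i%:Z * h%:Z - j%:Z * h%:Z)%R|)%N.
  move=> ij; rewrite -mulrBl abszM leq_pmull //; lia.
apply/negligibleP.
  apply: (@event_measurable _ setT); apply: event_not; exact: event_unbounded.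
have sub : [set c | ~ unbounded (skel c)] `<=`
    \bigcup_n (Z (up n) `|` Z (fun h i => - up n h i)).
  move=> c nu; apply: contrapT => H; apply: nu => m.
  have {}H : ~ Z (up `|m|%N) c /\ ~ Z (fun h i => - up `|m|%N h i) c.
    by split=> Zc; apply: H; exists `|m|%N => //; [left|right].
  have [H1 H2] := H; split.
    apply: contrapT => nS; apply: H1 => h i Si; apply: nS.
    by exists (up `|m|%N h i) => //; rewrite /up; lia.
  apply: contrapT => nS; apply: H2 => h i Si; apply: nS.
  by exists (- up `|m|%N h i) => //; rewrite /up; lia.
apply: (@negligibleS _ (cfg_space R) R mu _ _ sub).
apply: negligible_bigcup => n; apply: negligibleU; apply: nZ => h i j /(updist h).
  by rewrite /up !PoszD !PoszM; lia.
by rewrite /up !PoszD !PoszM; lia.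
Qed.

End Regeneration.

(** * Chains of cycles *)

Section Chains.
Variables (R : realType) (mu : probability (cfg_space R) R).
Hypothesis mu_iid : iid_rows mu.
Local Notation cycles := (fin_seq (nat_product (\bar R))).

(** The factors for [linf] and [rinf] at the ends are left out, since they belong to the whole
    chain. That the total mass is 1 only emerges in [weightT]. *)
Definition mu_cycle (D : set cycles) : \bar R :=
  (\sum_(0 <= m <oo) mu (block D 0 m.+1%:Z))%E.

Definition mu_cycle0 (D : set cycles) : \bar R :=
  (\sum_(0 <= i <oo) \sum_(0 <= j <oo) mu (block D (- i%:Z) j.+1%:Z))%E.

Lemma mu_block D a b : a <= b -> measurable D ->
  mu (block D a b) = mu (block D 0 (b - a)).
Proof.
move=> ab mD.
have mB : measurable (block D 0 (b - a) : set (cfg_space R)).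
  by apply: event_measurable (event_block _ mD); lia.
by rewrite -(mu_shift mu_iid a mB) block_shift add0r subrK.
Qed.

Variable D : int -> set cycles.
Hypothesis mD : forall k, measurable (D k).

(** A chain of [n] cycles numbered from [k] and starting at [a]. The closing [rinf] at the last
    endpoint is what makes the unions disjoint. *)
Fixpoint forward (n : nat) (k a : int) : set (config R) :=
  if n is n'.+1 then
    \bigcup_m (block (D k) a (a + m.+1%:Z) `&` forward n' (k + 1) (a + m.+1%:Z))
  else [set c | rinf (cedge c) a].

Fixpoint backward (n : nat) (k a : int) : set (config R) :=
  if n is n'.+1 then
    \bigcup_m (block (D (k - 1)) (a - m.+1%:Z) a `&`
               backward n' (k - 1) (a - m.+1%:Z))
  else [set c | linf (cedge c) a].

Definition two_sided (n m : nat) : set (config R) :=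
  \bigcup_i (backward n 0 (- i%:Z) `&`
    \bigcup_j (block (D 0) (- i%:Z) j.+1%:Z `&` forward m 1 j.+1%:Z)).

Lemma event_bigcup K (F : nat -> set (config R)) :
  (forall i, event K (F i)) -> event K (\bigcup_i F i).
Proof.
move=> mF; rewrite (_ : \bigcup_i F i = [set c | exists i, F i c]).
  exact: event_exists.
by apply/seteqP; split=> c [i]; exists i.
Qed.

Lemma event_forward n k a : event (rows_from a) (forward n k a).
Proof.
elim: n k a => [|n IH] k a; first exact: event_rinf.
apply: event_bigcup => m; apply: event_and.
  apply: eventS (event_block _ (mD k)) _; first by lia.
  by move=> e; rewrite /rows /rows_from /=; lia.
by apply: eventS (IH _ _) _ => e; rewrite /rows_from /=; lia.
Qed.

Lemma event_backward n k a : event (rows_before a) (backward n k a).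
Proof.
elim: n k a => [|n IH] k a; first exact: event_linf.
apply: event_bigcup => m; apply: event_and.
  apply: eventS (event_block _ (mD _)) _; first by lia.
  by move=> e; rewrite /rows /rows_before /=; lia.
by apply: eventS (IH _ _) _ => e; rewrite /rows_before /=; lia.
Qed.

(** The closing [rinf] travels back along the links of the blocks. *)
Lemma forward_rinf n k a c : forward n k a c -> rinf (cedge c) a.
Proof.
elim: n k a => [//|n IH] k a [m _ [[[lab _] _] /IH r]].
by apply: rinf_link lab => //; lia.
Qed.

Lemma backward_linf n k a c : backward n k a c -> linf (cedge c) a.
Proof.
elim: n k a => [//|n IH] k a [m _ [[[lab _] _] /IH r]].
by apply: linf_link lab => //; lia.
Qed.

Lemma trivIset_forward n k a : trivIset setT
  (fun m : nat => block (D k) a (a + m.+1%:Z) `&` forward n (k + 1) (a + m.+1%:Z)).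
Proof.
apply/trivIsetP => i j _ _ ij; apply/seteqP; split=> // c.
move=> [[[bi _] /forward_rinf ri] [[bj _] /forward_rinf rj]].
have : a + i.+1%:Z = a + j.+1%:Z by apply: cycle_block_inj_r bi bj ri rj; lia.
by move=> aij; move/eqP: ij => /=; lia.
Qed.

Lemma trivIset_backward n k a : trivIset setT
  (fun m : nat => block (D (k - 1)) (a - m.+1%:Z) a `&`
                  backward n (k - 1) (a - m.+1%:Z)).
Proof.
apply/trivIsetP => i j _ _ ij; apply/seteqP; split=> // c.
move=> [[[bi _] /backward_linf li] [[bj _] /backward_linf lj]].
have : a - i.+1%:Z = a - j.+1%:Z by apply: cycle_block_inj_l bi bj li lj; lia.
by move=> aij; move/eqP: ij => /=; lia.
Qed.

Lemma mu_fin K A : event K A -> mu A \is a fin_num.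
Proof. by move=> eA; apply: fin_num_measure; exact: event_measurable eA. Qed.

Lemma nneseriesZr_fin (f : nat -> \bar R) x : x \is a fin_num ->
  (forall i, 0 <= f i)%E ->
  (\sum_(0 <= i <oo) (f i * x) = (\sum_(0 <= i <oo) f i) * x)%E.
Proof.
case: x => // x _ f0; rewrite muleC -nneseriesZl //.
by apply: eq_eseriesr => i _; rewrite muleC.
Qed.

Lemma mu_bigcup (F : nat -> set (config R)) :
  (forall i, event setT (F i)) -> trivIset setT F ->
  mu (\bigcup_i F i) = (\sum_(0 <= i <oo) mu (F i))%E.
Proof.
move=> eF tF; rewrite measure_bigcup //; last first.
  by move=> i _; exact: event_measurable (eF i).
by apply: eq_eseriesl => i; rewrite in_setT.
Qed.

(** In each term the block and the rest of the chain use disjoint rows, and by induction the mass of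
    the rest does not depend on where it starts. It therefore leaves the sum over lengths, which is
    [mu_cycle (D k)]. *)
Lemma mu_forward n k a : mu (forward n k a) =
  (mu [set c | rinf (cedge c) 0%R] * \prod_(i < n) mu_cycle (D (k + i%:Z)))%E.
Proof.
elim: n k a => [|n IH] k a; first by rewrite big_ord0 mule1 /= (mu_rinf mu_iid a).
have e1 m : event (rows a (a + m.+1%:Z)) (block (D k) a (a + m.+1%:Z)).
  by apply: event_block => //; lia.
rewrite /= mu_bigcup; last exact: trivIset_forward.
- rewrite (eq_eseriesr (g := fun m => (mu (block (D k) 0 m.+1%:Z) *
    mu (forward n (k + 1) 0))%E)); last first.
    move=> m _.
    rewrite [LHS](event_indep mu_iid _ (e1 m) (event_forward n _ _)); last first.
      by apply/seteqP; split=> // e; rewrite /rows /rows_from /=; lia.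
    by rewrite !IH mu_block //; [rewrite addrAC subrr add0r|lia].
  rewrite nneseriesZr_fin //; last exact: mu_fin (event_forward _ _ _).
  rewrite IH big_ord_recl addr0 muleCA; congr (_ * (_ * _))%E.
  by apply: eq_bigr => i _; rewrite -addrA.
- move=> m; apply: event_and; [exact: eventS (e1 m) (@subsetT _ _)|].
  exact: eventS (event_forward _ _ _) (@subsetT _ _).
Qed.

Lemma mu_backward n k a : mu (backward n k a) =
  (mu [set c | linf (cedge c) 0%R] * \prod_(i < n) mu_cycle (D (k - 1 - i%:Z)))%E.
Proof.
elim: n k a => [|n IH] k a; first by rewrite big_ord0 mule1 /= (mu_linf mu_iid a).
have e1 m : event (rows (a - m.+1%:Z) a) (block (D (k - 1)) (a - m.+1%:Z) a).
  by apply: event_block => //; lia.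
rewrite /= mu_bigcup; last exact: trivIset_backward.
- rewrite (eq_eseriesr (g := fun m => (mu (block (D (k - 1)) 0 m.+1%:Z) *
    mu (backward n (k - 1) 0))%E)); last first.
    move=> m _.
    rewrite [LHS](event_indep mu_iid _ (e1 m) (event_backward n _ _)); last first.
      by apply/seteqP; split=> // e; rewrite /rows /rows_before /=; lia.
    rewrite !IH mu_block //; last by lia.
    by rewrite (_ : a - (a - _) = m.+1%:Z) //; lia.
  rewrite nneseriesZr_fin //; last exact: mu_fin (event_backward _ _ _).
  rewrite IH big_ord_recl subr0 muleCA; congr (_ * (_ * _))%E.
  by apply: eq_bigr => i _; congr (mu_cycle (D _)); rewrite lift0; lia.
- move=> m; apply: event_and; [exact: eventS (e1 m) (@subsetT _ _)|].
  exact: eventS (event_backward _ _ _) (@subsetT _ _).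
Qed.

Lemma consecutive_straddle (S : set int) a b a' b' :
  consecutive S a b -> consecutive S a' b' -> a <= 0 < b -> a' <= 0 < b' ->
  a = a' /\ b = b'.
Proof.
move=> Cab Ca'b' ab0 a'b'0; have [Sa Sb _ nab] := Cab.
have [Sa' Sb' _ na'b'] := Ca'b'.
have aa' : a = a'.
  have [aa'|aa'|//] := ltgtP a a'; exfalso.
    by apply: (nab a') => //; lia.
  by apply: (na'b' a) => //; lia.
by split=> //; rewrite -aa' in Ca'b'; exact: consecutive_fun Cab Ca'b'.
Qed.

Lemma two_sided_consecutive n m (i j : nat) c : backward n 0 (- i%:Z) c ->
  (block (D 0) (- i%:Z) j.+1%:Z `&` forward m 1 j.+1%:Z) c ->
  consecutive (skel c) (- i%:Z) j.+1%:Z.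
Proof.
move=> /backward_linf li [[bij _] /forward_rinf rj].
by apply/consecutiveP; first by lia.
Qed.

(** The rows split into those before [- i], those of the block around the origin, and those from
    [j + 1] on. The outer factors do not depend on [i] and [j]; the double sum that remains is
    [mu_cycle0]. *)
Lemma mu_two_sided n m : mu (two_sided n m) =
  (\prod_(i < n) mu_cycle (D (- 1 - i%:Z)) *
   (mu [set c | linf (cedge c) 0%R] * mu_cycle0 (D 0) *
     mu [set c | rinf (cedge c) 0%R]) *
   \prod_(i < m) mu_cycle (D (1 + i%:Z)))%E.
Proof.
have eB (i j : nat) : event (rows (- i%:Z) j.+1%:Z) (block (D 0) (- i%:Z) j.+1%:Z).
  by apply: event_block => //; lia.
have eBF (i j : nat) : event (rows_from (- i%:Z))
    (block (D 0) (- i%:Z) j.+1%:Z `&` forward m 1 j.+1%:Z).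
  apply: event_and.
    by apply: eventS (eB i j) _ => e; rewrite /rows /rows_from /=; lia.
  by apply: eventS (event_forward m 1 _) _ => e; rewrite /rows_from /=; lia.
have eT (K : set (int * nat)) (A : set (config R)) : event K A -> event setT A.
  by move=> eA; exact: eventS eA (@subsetT _ _).
rewrite /two_sided mu_bigcup; first last.
- apply/trivIsetP => i i' _ _ /eqP ii'; apply/seteqP; split=> // c.
  move=> [[bi [j _ fj]] [bi' [j' _ fj']]].
  have := consecutive_straddle (two_sided_consecutive bi fj)
    (two_sided_consecutive bi' fj').
  by move=> /(_ _)/(_ _)[]; lia.
- move=> i; apply: event_and; first exact: eT (event_backward _ _ _).
  by apply: event_bigcup => j; exact: eT (eBF i j).
rewrite (eq_eseriesr (g := fun i => (mu (backward n 0 0) *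
  ((\sum_(0 <= j <oo) mu (block (D 0) (- i%:Z) j.+1%:Z)) *
    mu (forward m 1 0)))%E)); last first.
  move=> i _.
  rewrite [LHS](event_indep mu_iid _ (event_backward n _ _)
    (event_bigcup (eBF i))); last first.
    by apply/seteqP; split=> // e; rewrite /rows_before /rows_from /=; lia.
  rewrite !mu_backward; congr (_ * _)%E.
  rewrite mu_bigcup; first last.
  - apply/trivIsetP => j j' _ _ /eqP jj'; apply/seteqP; split=> // c.
    move=> [[[bi _] /forward_rinf ri] [[bj _] /forward_rinf rj]].
    have : j.+1%:Z = j'.+1%:Z by apply: cycle_block_inj_r bi bj ri rj; lia.
    by lia.
  - by move=> j; exact: eT (eBF i j).
  rewrite -nneseriesZr_fin //; last exact: mu_fin (event_forward _ _ _).
  apply: eq_eseriesr => j _.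
  rewrite [LHS](event_indep mu_iid _ (eB i j) (event_forward m _ _)); last first.
    by apply/seteqP; split=> // e; rewrite /rows /rows_from /=; lia.
  by rewrite !mu_forward.
have finBF : (mu (backward n 0 0) * mu (forward m 1 0))%E \is a fin_num.
  by rewrite fin_numM //; [exact: mu_fin (event_backward _ _ _)|
                           exact: mu_fin (event_forward _ _ _)].
under eq_eseriesr do rewrite muleCA.
rewrite nneseriesZr_fin //; last by move=> i; apply: nneseries_ge0.
rewrite -/(mu_cycle0 (D 0)) mu_backward mu_forward sub0r.
move: (mu_cycle0 _) (mu [set c | linf _ _]) (mu [set c | rinf _ _]) => k l r.
move: (\prod_(i < n) _)%E (\prod_(i < m) _)%E => x y.
by rewrite -!muleA [RHS]muleCA (muleCA k l) (muleCA x k).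
Qed.

Definition row_Gamma (k : int) (c : config R) : int :=
  xget (fun=> 0) [set g | enumerates (skel c) g] k.

Definition row_cycle (k : int) (c : config R) : cycles :=
  word c (row_Gamma k c) (row_Gamma (k + 1) c).

Lemma row_Gamma_enumerates c :
  unbounded (skel c) -> enumerates (skel c) (fun k => row_Gamma k c).
Proof.
move=> /enumerates_exists[g gP]; rewrite /row_Gamma.
by case: xgetP => [//|/(_ g)].
Qed.

Lemma row_Gamma_bounded c k : ~ unbounded (skel c) -> row_Gamma k c = 0.
Proof.
move=> nu; rewrite /row_Gamma; case: xgetP => [g _ /enumerates_unbounded //|//].
Qed.

(** * Chains read along an actual enumeration *)

Section Enumerated.
Variables (c : config R) (g : int -> int).
Hypothesis gP : enumerates (skel c) g.

Lemma enumerated_lt k : g k < g (k + 1).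
Proof. by have [] := enumerates_consecutive gP k. Qed.

Lemma enumerated_block k : cycle_block (cedge c) (g k) (g (k + 1)).
Proof.
have := enumerates_consecutive gP k.
by move/(consecutiveP _ (enumerated_lt k)) => [].
Qed.

(** Only one term of the union defining [forward] can occur: a block that starts at a skeleton
    vertex and is closed by [rinf] must end at the next skeleton vertex. *)
Lemma forwardP n k : forward n k (g k) c <->
  forall i, (i < n)%N -> D (k + i%:Z) (word c (g (k + i%:Z)) (g (k + i%:Z + 1))).
Proof.
elim: n k => [|n IH] k.
  by split=> // _; have [_ ] := enumerates_in gP k.
split.
  move=> [m _ [[bm Dm] fm]].
  have gE : g (k + 1) = g k + m.+1%:Z.
    apply: enumerates_next gP _ _ _; apply/consecutiveP; first by lia.
    split=> //; last exact: forward_rinf fm.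
    by have [] := enumerates_in gP k.
  rewrite -gE in bm Dm fm.
  move=> [_|i]; first by rewrite addr0.
  rewrite ltnS => ni; have := (IH _).1 fm i ni.
  by rewrite -addrA -[in 1 + _]/(1%:Z) -PoszD add1n.
move=> H; pose m := `|g (k + 1) - g k|.-1.
have gE : g k + m.+1%:Z = g (k + 1) by rewrite /m; have := enumerated_lt k; lia.
exists m => //; rewrite gE; split.
  split; first exact: enumerated_block.
  by have := H 0%N isT; rewrite addr0.
apply/IH => i ni; have := H i.+1 ni.
by rewrite -[i.+1]add1n PoszD addrA.
Qed.

Lemma backwardP n k : backward n k (g k) c <->
  forall i, (i < n)%N ->
    D (k - 1 - i%:Z) (word c (g (k - 1 - i%:Z)) (g (k - 1 - i%:Z + 1))).
Proof.
elim: n k => [|n IH] k.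
  by split=> // _; have [] := enumerates_in gP k.
have glt := enumerated_lt (k - 1); have gblock := enumerated_block (k - 1).
rewrite subrK in glt gblock; split.
  move=> [m _ [[bm Dm] fm]].
  have gE : g (k - 1) = g k - m.+1%:Z.
    apply: enumerates_prev gP _ _ _; apply/consecutiveP; first by lia.
    split=> //; first exact: backward_linf fm.
    by have [] := enumerates_in gP k.
  rewrite -gE in bm Dm fm.
  move=> [_|i]; first by rewrite subr0 subrK.
  rewrite ltnS => ni; have := (IH _).1 fm i ni.
  by rewrite (_ : k - 1 - i.+1%:Z = k - 1 - 1 - i%:Z) //; lia.
move=> H; pose m := `|g k - g (k - 1)|.-1.
have gE : g k - m.+1%:Z = g (k - 1) by rewrite /m; lia.
exists m => //; rewrite gE; split.
  split=> //.
  by have := H 0%N isT; rewrite subr0 subrK.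
apply/IH => i ni; have := H i.+1 ni.
by rewrite (_ : k - 1 - i.+1%:Z = k - 1 - 1 - i%:Z) //; lia.
Qed.

Lemma two_sidedP n m : two_sided n m c <->
  forall k, - n%:Z <= k <= m%:Z -> D k (word c (g k) (g (k + 1))).
Proof.
have g01 : g 0 <= 0 < g 1 by case: gP.
split.
  move=> [i _ [bi [j _ fj]]].
  have Cij := two_sided_consecutive bi fj.
  have [|g0 g1] := consecutive_straddle (enumerates_consecutive gP 0) Cij g01.
    by lia.
  rewrite add0r in g1; move: fj => [[_ D0] fj].
  rewrite -g0 in bi D0; rewrite -g1 in D0 fj.
  move: bi fj => /backwardP bi /forwardP fj k knm.
  have [k0|k0|->] := ltgtP k 0.
  - have := bi `|k|.-1; rewrite (_ : 0 - 1 - `|k|.-1%:Z = k); last by lia.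
    by apply; lia.
  - have := fj `|k|.-1; rewrite (_ : 1 + `|k|.-1%:Z = k); last by lia.
    by apply; lia.
  - by rewrite add0r.
move=> H; exists `|g 0|%N => //.
have g0 : - `|g 0|%N%:Z = g 0 by move: (g 0) g01 => z; lia.
rewrite g0; split; first by apply/backwardP => i ni; apply: H; lia.
have g1 : `|g 1|.-1.+1%:Z = g 1 by move: (g 1) g01 => z; lia.
exists `|g 1|.-1 => //; rewrite g1; split; last first.
  by apply/forwardP => i ni; apply: H; lia.
split; first by have := enumerated_block 0; rewrite add0r.
by have := H 0; rewrite add0r; apply; lia.
Qed.

End Enumerated.

End Chains.

(** * Law of the cycles *)

Section CycleMeasurability.
Variable R : realType.
Local Notation cycles := (fin_seq (nat_product (\bar R))).

Lemma event_consecutive a b :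
  event setT [set c : config R | consecutive (skel c) a b].
Proof.
rewrite (_ : mkset _ = [set c | skel c a /\ skel c b /\ a < b /\
    forall x, a < x < b -> ~ skel c x]); last first.
  by apply/seteqP; split=> c; [case|case=> ? [? []]].
apply: event_and; first exact: event_skel.
apply: event_and; first exact: event_skel.
apply: event_when => _; apply: event_forall => x; apply: event_guard => _.
by apply: event_not; exact: event_skel.
Qed.

(** [row_Gamma] comes from a choice operator, so measurability is recovered from what characterizes
    it: index 0 by the consecutive pair around the origin, the others by successors and
    predecessors. *)
Lemma event_row_Gamma k a : event setT [set c : config R | row_Gamma k c = a].
Proof.
suff H : forall a,
    event setT [set c : config R | unbounded (skel c) /\ row_Gamma k c = a].
  (* Off the unbounded event the value is the default 0; the disjunction of the two cases is
     expressed by negation and conjunction. *)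
  rewrite (_ : mkset _ = [set c : config R |
    ~ (~ (unbounded (skel c) /\ row_Gamma k c = a) /\
       ~ (0 = a /\ ~ unbounded (skel c)))]); last first.
    apply/seteqP; split=> c /=.
      move=> ka [nA nB]; have [u|nu] := pselect (unbounded (skel c)).
        by apply: nA.
      by apply: nB; split=> //; rewrite -ka row_Gamma_bounded.
    move=> nn; apply: contrapT => ka; apply: nn; split=> [[] //|[a0 nu]].
    by apply: ka; rewrite row_Gamma_bounded.
  apply: event_not; apply: event_and; apply: event_not; first exact: H.
  by apply: event_when => _; apply: event_not; exact: event_unbounded.
have step (Q : config R -> int -> int -> Prop) k' :
    (forall a b, event setT [set c | Q c a b]) ->
    (forall a, event setT
      [set c : config R | unbounded (skel c) /\ row_Gamma k' c = a]) ->
    forall b, event setT [set c : config R |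
      exists a, Q c a b /\ (unbounded (skel c) /\ row_Gamma k' c = a)].
  move=> eQ ek b; apply: event_exists => a'; apply: event_and; first exact: eQ.
  exact: ek.
elim/int_ind: k => [|n IH|n IH] {}a.
- rewrite (_ : mkset _ = [set c : config R | unbounded (skel c) /\
     exists b, (a <= 0 < b) /\ consecutive (skel c) a b]).
    apply: event_and; first exact: event_unbounded.
    apply: event_exists => b; apply: event_when => _; exact: event_consecutive.
  apply/seteqP; split=> c [u].
    move=> /= <-; split=> //; have gP := row_Gamma_enumerates u.
    exists (row_Gamma 1 c); split; first by case: gP.
    exact: (enumerates_consecutive gP 0).
  move=> [b [ab Cab]]; split=> //.
  exact: (enumerates0 (row_Gamma_enumerates u) Cab ab).
- have := step (fun c a b => consecutive (skel c) a b) n event_consecutive IH a.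
  congr event; apply/seteqP; split=> c /=.
    move=> [b [Cba [u bE]]]; split=> //; rewrite -bE in Cba.
    by have := enumerates_next (row_Gamma_enumerates u) Cba; rewrite -addn1 PoszD.
  move=> [u aE]; exists (row_Gamma n c); split=> //; rewrite -aE -addn1 PoszD.
  exact: (enumerates_consecutive (row_Gamma_enumerates u)).
- have := step (fun c a b => consecutive (skel c) b a) (- n%:Z)
    (fun a b => event_consecutive b a) IH a.
  have nE : - n.+1%:Z = - n%:Z - 1 by lia.
  rewrite nE; congr event; apply/seteqP; split=> c /=.
    move=> [b [Cab [u bE]]]; split=> //; rewrite -bE in Cab.
    exact: (enumerates_prev (row_Gamma_enumerates u) Cab).
  move=> [u aE]; exists (row_Gamma (- n%:Z) c); split=> //; rewrite -aE.
  by have := enumerates_consecutive (row_Gamma_enumerates u) (- n%:Z - 1); rewrite subrK.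
Qed.

Lemma event_row_cycle k (A : set cycles) : measurable A ->
  event setT [set c | A (row_cycle k c)].
Proof.
move=> mA; rewrite (_ : mkset _ = [set c | exists a, exists b,
    row_Gamma k c = a /\ (row_Gamma (k + 1) c = b /\ A (word c a b))]); last first.
  apply/seteqP; split=> c /=; last by move=> [a [b [<- [<-]]]].
  by move=> Ac; exists (row_Gamma k c), (row_Gamma (k + 1) c).
apply: event_exists => a; apply: event_exists => b.
apply: event_and; first exact: event_row_Gamma.
apply: event_and; first exact: event_row_Gamma.
exact: event_word.
Qed.

Lemma skel_shift_rows n (c : config R) x : skel (shift_rows n c) x <-> skel c (x + n).
Proof.
by split=> -[l r]; split; (exact/linf_shift || exact/rinf_shift).
Qed.

Lemma measurable_skel : measurable_fun [set: cfg_space R]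
  (fun c : cfg_space R => skel c : int_set).
Proof.
apply: (@measurability _ _ (cfg_space R) int_set setT _ _ erefl).
move=> _ [_ [m _ <-] <-]; rewrite setTI.
exact: event_measurable (event_skel R m).
Qed.

Lemma measurable_translate (n : int) : measurable_fun [set: int_set]
  (fun S : int_set => [set x + n | x in S] : int_set).
Proof.
apply: (@measurability _ _ int_set int_set setT _ _ erefl).
move=> _ [_ [m _ <-] <-]; rewrite setTI; apply: sub_sigma_algebra.
exists (m - n) => //; apply/seteqP; split=> S /=.
  by move=> Sm; exists (m - n) => //; rewrite subrK.
by move=> [x Sx <-]; rewrite addrK.
Qed.

Lemma measurable_range_row_Gamma : measurable_fun [set: cfg_space R]
  (fun c : cfg_space R => range (fun k => row_Gamma k c) : int_set).
Proof.
apply: (@measurability _ _ (cfg_space R) int_set setT _ _ erefl).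
move=> _ [_ [m _ <-] <-]; rewrite setTI.
rewrite (_ : _ @^-1` _ = [set c : config R | exists k, row_Gamma k c = m]).
  apply: (@event_measurable _ setT); apply: event_exists => k; exact: event_row_Gamma.
by apply/seteqP; split=> c /=; [case=> k _ <-; exists k|case=> k <-; exists k].
Qed.

End CycleMeasurability.

Section CycleLaw.
Variables (R : realType) (mu : probability (cfg_space R) R).
Hypothesis mu_iid : iid_rows mu.
Hypothesis rinf_gt0 : (0 < mu [set c | rinf (cedge c) 0])%E.
Hypothesis linf_gt0 : (0 < mu [set c | linf (cedge c) 0])%E.
Local Notation cycles := (fin_seq (nat_product (\bar R))).

(** By [unbounded_ae] the configurations left out form a null set; identities valid only along an
    enumeration thus become equalities of probabilities. *)
Lemma mu_eq_unbounded A B : event setT A -> event setT B ->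
  (forall c : config R, unbounded (skel c) -> A c <-> B c) -> mu A = mu B.
Proof.
suff le A' B' : event setT A' -> event setT B' ->
    (forall c : config R, unbounded (skel c) -> A' c -> B' c) -> (mu A' <= mu B')%E.
  move=> eA eB AB; apply/eqP; rewrite eq_le !le //.
  - by move=> c /AB [].
  - by move=> c /AB [].
move=> eA eB AB; pose N := [set c : config R | ~ unbounded (skel c)].
have mA := event_measurable eA; have mB := event_measurable eB.
have mN : measurable (N : set (cfg_space R)).
  by apply: (@event_measurable _ setT); apply: event_not; exact: event_unbounded.
apply: (@le_trans _ _ (mu (B' `|` N))).
  apply: le_measure; rewrite ?inE //; first exact: measurableU.
  move=> c Ac; have [u|nu] := pselect (unbounded (skel c)); last by right.
  by left; exact: AB.
apply: (le_trans (measureU2 _ mB mN)).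
have N0 : mu N = 0%E by exact: (unbounded_ae mu_iid rinf_gt0 linf_gt0).
by rewrite [X in (_ + X)%E]N0 adde0.
Qed.

Definition window (n m : nat) : seq int :=
  [seq - 1 - i%:Z | i <- iota 0 n] ++ 0 :: [seq 1 + i%:Z | i <- iota 0 m].

Lemma mem_window n m k : (k \in window n m) = (- n%:Z <= k <= m%:Z).
Proof.
rewrite mem_cat inE; apply/idP/idP.
  by move=> /or3P[/mapP[i]|/eqP ->|/mapP[i]]; rewrite ?mem_iota; lia.
move=> knm; have [k0|k0|->] := ltgtP k 0; last by rewrite orbT.
- by apply/orP; left; apply/mapP; exists `|k|.-1; rewrite ?mem_iota; lia.
- apply/orP; right; apply/orP; right.
  by apply/mapP; exists `|k|.-1; rewrite ?mem_iota; lia.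
Qed.

Lemma window_uniq n m : uniq (window n m).
Proof.
have minj : uniq [seq - 1 - i%:Z | i <- iota 0 n].
  by rewrite map_inj_in_uniq ?iota_uniq // => i j _ _; lia.
have pinj : uniq [seq 1 + i%:Z | i <- iota 0 m].
  by rewrite map_inj_in_uniq ?iota_uniq // => i j _ _; lia.
rewrite cat_uniq cons_uniq minj pinj andTb andbT; apply/andP; split.
  by apply/hasPn => k; rewrite inE => /predU1P[->|/mapP[i _ ->]];
     apply/mapP => -[j _]; lia.
by apply/mapP => -[i _]; lia.
Qed.

Definition weight (k : int) (A : set cycles) : \bar R :=
  if k == 0 then (mu [set c | linf (cedge c) 0%R] * mu_cycle0 mu A *
                  mu [set c | rinf (cedge c) 0%R])%E
  else mu_cycle mu A.

Lemma mu_window n m (A : int -> set cycles) : (forall k, measurable (A k)) ->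
  mu [set c | forall k, k \in window n m -> A k (row_cycle k c)] =
  (\prod_(k <- window n m) weight k (A k))%E.
Proof.
move=> mA.
have eA : event setT [set c | forall k, k \in window n m -> A k (row_cycle k c)].
  apply: event_forall => k; apply: event_guard => _; exact: event_row_cycle.
have -> : mu [set c | forall k, k \in window n m -> A k (row_cycle k c)] =
          mu (two_sided A n m).
  apply: mu_eq_unbounded => //.
    apply: event_bigcup => i; apply: event_and.
      by apply: eventS (event_backward mA _ _ _) _.
    apply: event_bigcup => j; apply: event_and.
      by apply: eventS (event_block _ (mA 0)) _ => //; lia.
    by apply: eventS (event_forward mA _ _ _) _.
  move=> c u; have gP := row_Gamma_enumerates u; split.
    by move=> H; apply/(two_sidedP _ gP) => k knm; apply: H; rewrite mem_window.
  by move=> /(two_sidedP _ gP) H k; rewrite mem_window; exact: H.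
rewrite mu_two_sided // /window big_cat big_cons !big_map /=.
have iotaE (F : nat -> \bar R) l : (\prod_(i <- iota 0 l) F i = \prod_(i < l) F i)%E.
  by rewrite -(big_mkord xpredT F) /index_iota subn0.
rewrite !iotaE -muleA; congr (_ * (_ * _))%E.
by apply: eq_bigr => i _; rewrite /weight ifF //; lia.
Qed.

(** The windows [{0}] and [{0, 1}] suffice, since all non-zero indices share one weight. *)
Lemma weightT k : weight k setT = 1%E.
Proof.
have w0 : weight 0 setT = 1%E.
  have := mu_window 0 0 (A := fun=> setT) (fun=> measurableT).
  rewrite /window /= big_seq1 => <-; rewrite -(probability_setT mu).
  by congr (mu _); apply/seteqP; split.
have : (weight 0 setT * weight 1 setT = 1)%E.
  have := mu_window 0 1 (A := fun=> setT) (fun=> measurableT).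
  rewrite /window /= big_cons big_seq1 => <-; rewrite -(probability_setT mu).
  by congr (mu _); apply/seteqP; split.
rewrite w0 mul1e => w1; have [->//|k0] := eqVneq k 0.
by rewrite -w1 /weight (negbTE k0).
Qed.

(** [J] is completed to a symmetric window by full sets, which have weight 1. *)
Lemma mu_row_cycles (J : {fset int}) (A : int -> set cycles) :
  (forall k, measurable (A k)) ->
  mu [set c | forall k, k \in J -> A k (row_cycle k c)] =
  (\prod_(k <- J) weight k (A k))%E.
Proof.
move=> mA; pose n := (\max_(k <- J) `|k|)%N.
have Jn k : k \in J -> k \in window n n.
  rewrite mem_window => kJ.
  have : (`|k| <= n)%N by exact: (@leq_bigmax_seq _ _ predT).
  lia.
pose A' k := if k \in J then A k else setT.
have mA' k : measurable (A' k) by rewrite /A'; case: ifP.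
have -> : [set c | forall k, k \in J -> A k (row_cycle k c)] =
    [set c | forall k, k \in window n n -> A' k (row_cycle k c)].
  apply/seteqP; split=> c H k kJ; rewrite /A'.
    by case: ifP => // /H.
  by have := H k (Jn k kJ); rewrite /A' kJ.
rewrite mu_window // (bigID (mem J)) /= [X in (_ * X)%E]big1; last first.
  by move=> k /negbTE kJ; rewrite /A' kJ weightT.
rewrite mule1 -big_filter.
have JE : perm_eq [seq k <- window n n | k \in J] J.
  apply: uniq_perm; rewrite ?filter_uniq ?window_uniq // => k.
  by rewrite mem_filter; apply/andP/idP => [[]//|kJ]; split=> //; exact: Jn.
rewrite (perm_big _ JE) /= big_seq [RHS]big_seq; apply: eq_bigr => k kJ.
by rewrite /A' kJ.
Qed.

Lemma mu_row_cycle k (A : set cycles) : measurable A ->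
  mu [set c | A (row_cycle k c)] = weight k A.
Proof.
move=> mA; have := @mu_row_cycles [fset k]%fset (fun=> A) (fun=> mA).
rewrite big_seq_fset1 => <-; congr (mu _).
apply/seteqP; split=> c /=; last by apply; rewrite inE.
by move=> Ac k'; rewrite inE => /eqP ->.
Qed.

End CycleLaw.

(** * From rows to the random graph *)

(** [Y] may leave the two points on a null set: decomposing the full event shows that the remainder
    [O setT] has mass [1 - q - (1 - q) = 0]. *)
Lemma two_point_law d (T : measurableType d) (R : realType)
    (P : probability T R) (Y : T -> \bar R) (q : R) (B : set (\bar R)) :
  measurable_fun setT Y -> measurable B ->
  P [set w | Y w = 1%E] = q%:E -> P [set w | Y w = -oo%E] = (1 - q)%:E ->
  P [set w | B (Y w)] =
    ((if 1%E \in B then q else 0)%:E + (if -oo%E \in B then 1 - q else 0)%:E)%E.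
Proof.
move=> mY mB P1 P2.
have mpre (C : set (\bar R)) : measurable C -> measurable [set w | C (Y w)].
  by move=> mC; rewrite -[X in measurable X]setTI; exact: mY.
have m1 := mpre _ (emeasurable_set1 1%E); have m2 := mpre _ (emeasurable_set1 -oo%E).
pose O (C : set (\bar R)) :=
  [set w | C (Y w)] `\` [set w | Y w = 1%E] `\` [set w | Y w = -oo%E].
have split3 C : measurable C -> P [set w | C (Y w)] =
    (P (O C) + (if -oo%E \in C then 1 - q else 0)%:E + (if 1%E \in C then q else 0)%:E)%E.
  move=> /mpre mC; rewrite (measureDI _ mC m1); congr (_ + _)%E.
    rewrite (measureDI _ (measurableD mC m1) m2); congr (_ + _)%E.
    case: ifPn => CY; last first.
      transitivity (P set0); last exact: measure0.
      congr (P _); apply/seteqP; split=> // w [[Cw _] /= Yw]; move/negP: CY; apply.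
      by rewrite inE -Yw.
    rewrite -P2; congr (P _); apply/seteqP; split=> w /=; first by case.
    by move=> Yw; rewrite Yw; split=> //; split=> //; rewrite inE in CY.
  case: ifPn => CY; last first.
    transitivity (P set0); last exact: measure0.
    congr (P _); apply/seteqP; split=> // w [Cw /= Yw]; move/negP: CY; apply.
    by rewrite inE -Yw.
  rewrite -P1; congr (P _); apply/seteqP; split=> w /=; first by case.
  by move=> Yw; rewrite Yw; split=> //; rewrite inE in CY.
have mO C : measurable C -> measurable (O C).
  by move=> mC; apply: measurableD => //; apply: measurableD => //; exact: mpre.
have OT : P (O setT) = 0%E.
  have := split3 _ measurableT; rewrite !in_setT.
  rewrite (_ : [set w | setT (Y w)] = setT) // probability_setT.
  have : P (O setT) \is a fin_num by apply: fin_num_measure; exact: mO.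
  case: (P (O setT)) => // o _ [] H; congr (_%:E); lra.
have OB : P (O B) = 0%E.
  apply: (subset_measure0 _ _ _ OT); [exact: mO|exact: mO|].
  by move=> w [[_ ?] ?].
by rewrite split3 // OB add0e addeC.
Qed.

Section Transfer.
Context d (T : measurableType d) (R : realType).
Variables (P : probability T R) (p : nat -> R) (alpha : int -> int -> T -> \bar R).
Hypothesis graph : random_line_graph P p alpha.

Definition rows_of (w : T) : config R := fun n => delta alpha n w.

Lemma edgeE w : edge alpha w = cedge (rows_of w).
Proof.
apply/funext => i; apply/funext => j; rewrite /edge /cedge /rows_of /delta.
have [ij|//] := ltP i j; congr (alpha _ _ _ == _); lia.
Qed.

Lemma skeleton_rows w : skeleton alpha w = skel (rows_of w).
Proof. by rewrite skeletonE edgeE. Qed.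

Lemma Gamma_rows k w : Gamma alpha k w = row_Gamma k (rows_of w).
Proof. by rewrite /Gamma /row_Gamma skeleton_rows. Qed.

Lemma skeleton_cycle_rows k w : skeleton_cycle alpha k w = row_cycle k (rows_of w).
Proof. by rewrite /skeleton_cycle /row_cycle /word !Gamma_rows. Qed.

Lemma alpha_measurable i j : i < j -> measurable_fun setT (alpha i j).
Proof.
by move=> ij; have [[mal _] _] := graph; exact: (mal (exist _ (i, j) ij)).
Qed.

Lemma measurable_rows_of : measurable_fun [set: T] (rows_of : T -> cfg_space R).
Proof.
apply: (@measurability _ _ T (cfg_space R) setT rows_of (cylinder setT) erefl).
move=> _ [A [J [B [mB KJ BT ->]]] <-]; rewrite setTI.
rewrite (_ : _ @^-1` _ =
    \bigcap_(e in [set` J]) (fun w => rows_of w e.1 e.2) @^-1` B e).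
  apply: fin_bigcap_measurable => // e _.
  rewrite -[X in measurable X]setTI; apply: alpha_measurable => //; lia.
apply/seteqP; split=> w /=; first by move=> H e _; exact: H.
by move=> H e; have [eJ|/BT ->//] := boolP (e \in J); exact: H.
Qed.

Definition rows_law : probability (cfg_space R) R :=
  distribution P (mfun_Sub (mem_set measurable_rows_of)).

Lemma rows_lawE A : rows_law A = P (rows_of @^-1` A).
Proof. by []. Qed.

Lemma rows_law_edge i m : rows_law [set c | c i m = 1%E] = (p m.+1)%:E.
Proof.
have [_ /(_ i (i + m.+1%:Z))[|E _]] := graph; first by lia.
by rewrite rows_lawE [LHS]E; congr (p _)%:E; lia.
Qed.

(** Edges [(i, j)] are reindexed by [(i, m)] with [j = i + m + 1]. Rows agree in law because
    [p m.+1] determines the law of an entry, by [two_point_law]. *)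
Lemma iid_rows_law : iid_rows rows_law.
Proof.
have [[_ prodE] law] := graph; split=> [J B mB BT|i j m B mB]; last first.
  have lawE k : rows_law [set c | B (c k m)] =
      ((if 1%E \in B then p m.+1 else 0)%:E +
       (if -oo%E \in B then 1 - p m.+1 else 0)%:E)%E.
    have [|E1 E2] := law k (k + m.+1%:Z); first by lia.
    have lenE : `|(k + m.+1%:Z - k)%R|%N = m.+1 by lia.
    rewrite lenE in E1 E2.
    by apply: (two_point_law _ mB E1 E2); apply: alpha_measurable; lia.
  by rewrite !lawE.
have lt (e : int * nat) : (e.1, e.1 + e.2.+1%:Z).1 < (e.1, e.1 + e.2.+1%:Z).2.
  by rewrite /=; lia.
pose f (e : int * nat) : {e : int * int | e.1 < e.2} := 
  exist (fun e => e.1 < e.2) (e.1, e.1 + e.2.+1%:Z) (lt e).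
pose g (e : {e : int * int | e.1 < e.2}) : int * nat :=
  ((val e).1, `|(val e).2 - (val e).1|.-1).
have fK : cancel f g by move=> [i m]; rewrite /g /f /=; congr (_, _); lia.
have := prodE [fset f e | e in J]%fset (fun e => B (g e)) (fun e => mB _).
rewrite big_imfset /=; last by move=> x y _ _; exact: (can_inj fK).
under eq_bigr => e _ do rewrite fK.
move=> <-; rewrite rows_lawE; congr (P _); apply/seteqP; split=> w /=.
  by move=> H _ /imfsetP[e _ ->]; rewrite /= fK; exact: H.
move=> H e; have [eJ|/BT ->//] := boolP (e \in J).
have := H (f e); rewrite /= fK; apply; exact: in_imfset.
Qed.

End Transfer.

Theorem lemma5 (R : realType) (d : measure_display) (T : measurableType d)
    (P : probability T R) (p : nat -> R) (alpha : int -> int -> T -> \bar R)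
    (hp : forall j : nat, (1 <= j)%N -> 0 <= p j < 1)
    (hp1 : 0 < p 1%N < 1)
    (hsum : (\sum_(1 <= k <oo) (\prod_(1 <= j < k.+1) (1 - p j))%:E < +oo)%E)
    (hgraph : random_line_graph P p alpha) :
  [/\ {ae P, forall w, enumerates (skeleton alpha w) (fun k => Gamma alpha k w)},
      independent P (skeleton_cycle alpha),
      (forall k l : int, k != 0 -> l != 0 ->
         same_law P (skeleton_cycle alpha k) (skeleton_cycle alpha l)) &
      stationary_renewal P (Gamma alpha)].
Proof.
have iid := iid_rows_law hgraph.
have mu1 := rows_law_edge hgraph.
have [p1_gt0 _] := andP hp1.
have rpos := rinf0_gt0 iid mu1 hp p1_gt0 hsum.
have lpos := linf0_gt0 iid mu1 hp p1_gt0 hsum.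
pose mu := rows_law hgraph.
pose X := rows_of alpha.
have muE A : P (X @^-1` A) = mu A by [].
have mX (A : set (config R)) : event setT A -> measurable (X @^-1` A).
  move=> /event_measurable mA; rewrite -[_ @^-1` _]setTI.
  exact: (measurable_rows_of hgraph measurableT).
have cycE k : skeleton_cycle alpha k = row_cycle k \o X.
  by apply/funext => w; exact: skeleton_cycle_rows.
have mcyc k : measurable_fun setT (skeleton_cycle alpha k).
  move=> _ A mA; rewrite setTI cycE.
  exact: (mX _ (event_row_cycle k mA)).
have cyc_law k A : measurable A ->
    P (skeleton_cycle alpha k @^-1` A) = weight mu k A.
  by move=> mA; rewrite cycE; exact: (mu_row_cycle iid rpos lpos k mA).
have indep : independent P (skeleton_cycle alpha).
  split=> // J A mA; under eq_bigr do rewrite cyc_law //.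
  rewrite -(mu_row_cycles iid rpos lpos J mA) -muE.
  by congr (P _); apply/seteqP; split=> w /= H k kJ; have := H k kJ; rewrite cycE.
have same k l : k != 0 -> l != 0 ->
    same_law P (skeleton_cycle alpha k) (skeleton_cycle alpha l).
  by move=> k0 l0 A mA; rewrite !cyc_law // /weight (negbTE k0) (negbTE l0).
split=> //.
  exists (X @^-1` [set c | ~ unbounded (skel c)]); split.
  - by apply: mX; apply: event_not; exact: event_unbounded.
  - by rewrite muE; exact: (unbounded_ae iid rpos lpos).
  - move=> w /= H u; apply: H; rewrite skeleton_rows.
    have := row_Gamma_enumerates u; congr (enumerates _ _).
    by apply/funext => k; rewrite Gamma_rows.
(* A gap is the length of its cycle, so its properties follow from those of cycles. [len A] is
   measurable because its trace on tuples of a given length is full or empty. *)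
pose len (A : set int) : set (fin_seq (nat_product (\bar R))) :=
  [set s | A (size s)%:Z].
have mlen A : measurable (len A).
  move=> n; have [An|nAn] := pselect (A n%:Z).
    rewrite (_ : mkset _ = setT); first exact: measurableT.
    by apply/seteqP; split=> // t _; rewrite /len /= size_tuple.
  rewrite (_ : mkset _ = set0); first exact: measurable0.
  by apply/seteqP; split=> // t; rewrite /len /= size_tuple.
have gapE k A : (fun w => Gamma alpha (k + 1) w - Gamma alpha k w) @^-1` A =
    skeleton_cycle alpha k @^-1` len A.
  (* The cycle length is an absolute value, so the gap must be non-negative for every [w]; when the
     skeleton is not unbounded both terms are 0. *)
  have gap_ge0 w : Gamma alpha k w <= Gamma alpha (k + 1) w.
    rewrite !Gamma_rows; have [u|nu] := pselect (unbounded (skel (X w))).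
      by have [_ _ /ltW] := enumerates_consecutive (row_Gamma_enumerates u) k.
    by rewrite !row_Gamma_bounded.
  by apply/seteqP; split=> w; rewrite /len /= size_mkseq gez0_abs // subr_ge0.
split.
- have mrange (A : set int_set) : measurable A -> event setT [set c : config R |
      A (range (fun k => row_Gamma k c) : int_set)].
    move=> mA; split; have := @measurable_range_row_Gamma R measurableT A mA.
    by rewrite setTI.
  have mskel (A : set int_set) : measurable A ->
      event setT [set c : config R | A (skel c : int_set)].
    by move=> mA; split; have := @measurable_skel R measurableT A mA; rewrite setTI.
  have range_skel (c : config R) : unbounded (skel c) ->
      range (fun k => row_Gamma k c) = skel c.
    by move=> /row_Gamma_enumerates[].
  have rangeE w : range (fun k => Gamma alpha k w) = range (fun k => row_Gamma k (X w)).
    by congr (image setT _); apply/funext => k; rewrite Gamma_rows.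
  split=> [_ A mA|n A mA].
    rewrite setTI (_ : _ @^-1` A =
      X @^-1` [set c | A (range (fun k => row_Gamma k c) : int_set)]).
      exact: mX (mrange A mA).
    by apply/seteqP; split=> w /=; rewrite rangeE.
  pose An := (fun S : int_set => [set x + n | x in S] : int_set) @^-1` A.
  have mAn : measurable An.
    by have := measurable_translate n measurableT mA; rewrite setTI.
  (* The enumerated set equals the skeleton only almost surely, hence the passage to [skel] and
     back; for [skel], translating by [n] amounts to shifting the rows by [- n]. *)
  transitivity (mu [set c | A (range (fun k => row_Gamma k c) : int_set)]).
    by rewrite -muE; congr (P _); apply/seteqP; split=> w /=; rewrite rangeE.
  transitivity (mu [set c | An (range (fun k => row_Gamma k c) : int_set)]); last first.
    by rewrite -muE; congr (P _); apply/seteqP; split=> w; rewrite /An /= rangeE.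
  transitivity (mu [set c | A (skel c : int_set)]).
    apply: (mu_eq_unbounded iid rpos lpos (mrange _ mA) (mskel _ mA)) => c /range_skel.
    by rewrite /= => ->.
  transitivity (mu [set c | An (skel c : int_set)]); last first.
    apply: (mu_eq_unbounded iid rpos lpos (mskel _ mAn) (mrange _ mAn)) => c /range_skel.
    by rewrite /= => ->.
  rewrite -(mu_shift iid (- n) (event_measurable (mskel _ mA))).
  congr (mu _); apply/seteqP.
  have skelE (c : config R) : skel (shift_rows (- n) c) = [set x + n | x in skel c].
    apply/seteqP; split=> x.
      by move/skel_shift_rows; exists (x - n); rewrite ?subrK.
    by move=> [y Sy <-]; apply/skel_shift_rows; rewrite addrK.
  by split=> c; rewrite /An /= skelE.
- split=> [k _ A mA|J A mA].
    by rewrite gapE; exact: (mcyc k measurableT _ (mlen A)).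
  under eq_bigcapr do rewrite gapE.
  by rewrite indep.2 //; apply: eq_bigr => k _; rewrite gapE.
- by move=> k l k0 l0 A mA; rewrite !gapE; exact: same.
Qed.
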